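(* Let $N\ge 1$ and, for $i=1,\dots,N$, let $\bar{\mathcal S}_i\subseteq\mathbb R^3$ be the admissible operating-point set of converter $i$ and let $\mathcal S_i\subseteq\bar{\mathcal S}_i$ be a nonempty subset. Let $G,H\in\mathcal{RH}_\infty^{m\times m}$, where, for every $\mathcal O=[\mathcal O_1^\top,\dots,\mathcal O_N^\top]^\top$ with $\mathcal O_i\in\mathcal S_i$, $G(\cdot,\mathcal O)$ is block-diagonal, $$G(s,\mathcal O)=\operatorname{diag}\{G_1(s,\mathcal O_1),\dots,G_N(s,\mathcal O_N)\},$$ with square blocks, the $i$-th block depending only on $s$ and $\mathcal O_i$, and where $H\succ0$ is a constant positive-definite matrix. Suppose that for every $\mathcal O\in\mathcal S_1\times\cdots\times\mathcal S_N$ and every $\omega\in[0,\infty)$ at least one of the following conditions holds: 1) (gain) $\max_i\overline\sigma(G_i(j\omega,\mathcal O_i))<\underline\sigma(H^{-1})$; 2) (phase) $\max_i\overline\phi(G_i(j\omega,\mathcal O_i))<\pi$, and $\min_i\underline\phi(G_i(j\omega,\mathcal O_i))>-\pi$, and $\max_i\overline\phi(G_i(j\omega,\mathcal O_i))-\min_i\underline\phi(G_i(j\omega,\mathcal O_i))<\pi$; 3) ($x$-$z$ graph separation) for each $i\in\{1,\dots,N\}$ and all $\tau\in(0,1]$, $$P_{xz}(G_i(j\omega,\mathcal O_i))\cap P_{xz}\left(-\tfrac1\tau H^{-1}\right)=\varnothing;$$ 4) (SRG separation) for each $i\in\{1,\dots,N\}$ and all $\tau\in(0,1]$, $$SRG(G_i(j\omega,\mathcal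 O_i))\cap SRG\left(-\tfrac1\tau H^{-1}\right)=\varnothing.$$ Then the closed-loop system $G(s,\mathcal O)\,\#\,H$ is stable for all $\mathcal O\in\mathcal S_1\times\cdots\times\mathcal S_N$. Moreover, conditions 3) and 4) are equivalent.
   Context: Operating points: $\mathcal O_i=[P_i,Q_i,V_i]^\top\in\mathbb R^3$ (active power, reactive power, voltage magnitude). The admissible set is $\bar{\mathcal S}_i=\{\mathcal O_i: P_i^2+Q_i^2\le\kappa_i^2,\ \angle(P_i+\mathrm jQ_i)\in\Psi_i,\ V_i\in\mathcal V_i\}$ for given $\kappa_i$, angle range $\Psi_i$ and voltage set $\mathcal V_i$. $\mathcal{RH}_\infty^{m\times m}$ is the set of $m\times m$ proper real-rational transfer matrices with all poles in the open left half-plane. $G\,\#\,H$ denotes the (negative) feedback interconnection of $G$ and $H$. With $G\in\mathcal{RH}_\infty^{m\times m}$ and $H$ constant, it is stable iff $I+GH$ is invertible with $(I+GH)^{-1}\in\mathcal{RH}_\infty^{m\times m}$. For $A\in\mathbb C^{n\times n}$ (with $\|\cdot\|$ the Euclidean norm and $v^*$ the conjugate transpose): - $\overline\sigma(A)$ and $\underline\sigma(A)$ are the largest and smallest singular values. - The numerical range is $W(A)=\{v^*Av: v\in\mathbb C^n,\|v\|=1\}$; $A$ is sectorial if $0\notin W(A)$. A sectorial $A$ can be written $A=T^*DT$ with $T$ nonsingular and $D$ diagonal unitary, where $D$ is unique up to permutation and its diagonal entries lie on an arc of the unit circle of length less than $\pi$. The phases $\overline\phi(A)=\phi_1(A)\ge\dots\ge\phi_n(A)=\underline\phi(A)$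 are the arguments of the diagonal entries (eigenvalues) of $D$, chosen so that $\overline\phi(A)-\underline\phi(A)<\pi$. They are determined up to a common multiple of $2\pi$. The phase condition is understood to include that every $G_i(j\omega,\mathcal O_i)$ is sectorial (so that its phases are defined), and to hold for some such choice of the phases of each $G_i(j\omega,\mathcal O_i)$. - The $x$-$z$ graph is $P_{xz}(A)=\{(\Re(v^*Av),\|Av\|^2): v\in\mathbb C^n,\|v\|=1\}\subset\mathbb R^2$. - The scaled relative graph is $SRG(A)=\{c\in\mathbb C:\ \Re(c)=\Re(v^*Av),\ |c|=\|Av\|\ \text{for some } v\in\mathbb C^n,\ \|v\|=1\}$.
   Formalization: One of conditions 1)–4) is required for every ω in [0,∞], including ω=∞ where G_i(∞,O_i) is the limit; with ω in [0,∞) only, the claim fails for merely proper G, e.g. N=m=1, H=1, G(s)=-s/(s+1), where (1+G)^{-1}=s+1 is not proper. *)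

(* Defs.v *)
(* MathComp world: the reals are an arbitrary [R : realType], the complex
   numbers are [R[i]]. *)
From HB Require Import structures.
From mathcomp Require Import all_boot all_order all_algebra.
From mathcomp Require Import generic_quotient fraction sesquilinear spectral.
From mathcomp Require Import complex.
From mathcomp Require Import all_classical all_reals.
From mathcomp Require Import trigo.

Set Implicit Arguments.
Unset Strict Implicit.
Unset Printing Implicit Defensive.

Import Order.TTheory GRing.Theory Num.Theory.
Local Open Scope classical_set_scope.
Local Open Scope sesquilinear_scope.
Local Open Scope complex_scope.
Local Open Scope ring_scope.

Section TransferMatrices.
Variable R : realType.

Definition ratfun : fieldType := {fraction {poly R}}.

Local Notation "x %:F" := (@FracField.tofrac {poly R} x).

(* Lowest-terms numerator and denominator. They are determined up to a common
   nonzero constant factor, which does not affect anything defined below. *)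
Definition rnum (f : ratfun) : {poly R} :=
  let r := repr f in \n_r %/ gcdp \n_r \d_r.
Definition rden (f : ratfun) : {poly R} :=
  let r := repr f in \d_r %/ gcdp \n_r \d_r.

Lemma coprimep_rnum_rden (f : ratfun) : coprimep (rnum f) (rden f).
Proof.
by apply: coprimep_div_gcd; apply/orP; right; apply: denom_ratioP.
Qed.

Lemma rden_neq0 (f : ratfun) : rden f != 0.
Proof. by rewrite dvdp_div_eq0 ?dvdp_gcdr ?denom_ratioP. Qed.

Lemma ratfunE (f : ratfun) : f = (rnum f)%:F / (rden f)%:F.
Proof.
have fE : f * (\d_(repr f))%:F = (\n_(repr f))%:F.
  rewrite -{1}[f]reprK; unlock FracField.tofrac.
  rewrite -[LHS]FracField.pi_mul; apply/eqmodP/eqP => /=.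
  rewrite !numden_Ratio ?mulf_neq0 ?oner_neq0 ?denom_ratioP // !mulr1.
  by rewrite mulrC.
have dE : (rden f)%:F != 0 by rewrite tofrac_eq0 rden_neq0.
apply: (mulIf dE); rewrite divfK //.
set g := gcdp \n_(repr f) \d_(repr f).
have gE : g%:F != 0 :> ratfun.
  by rewrite tofrac_eq0 gcdp_eq0 negb_and denom_ratioP orbT.
apply: (mulIf gE); rewrite -mulrA -!rmorphM /rnum /rden /=.
by rewrite !divpK ?dvdp_gcdl ?dvdp_gcdr.
Qed.

Definition ceval (p : {poly R}) (s : R[i]) : R[i] :=
  (map_poly (real_complex R) p).[s].

Definition is_pole (f : ratfun) (s : R[i]) : Prop := ceval (rden f) s = 0.

Definition proper (f : ratfun) : Prop := (size (rnum f) <= size (rden f))%N.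

Definition RHinf m (M : 'M[ratfun]_m) : Prop :=
  forall i j, proper (M i j) /\
    forall s : R[i], is_pole (M i j) s -> complex.Re s < 0.

(* [f] at [j w]; for proper [f] the value at [w = +oo] is the limit of [f s] as
   [|s|] tends to infinity. Frequency conditions for transfer matrices that are
   not strictly proper have to include [w = +oo]: G = -s/(s+1) satisfies
   |G(jw)| < 1 for every finite w, but (1 + G)^-1 = s + 1 is not proper. *)
Definition freq_fun (f : ratfun) (w : \bar R) : R[i] :=
  if w is w'%:E then ceval (rnum f) (0 +i* w') / ceval (rden f) (0 +i* w')
  else ((rnum f)`_(size (rden f)).-1 / lead_coef (rden f))%:C.

Definition freq_resp m (M : 'M[ratfun]_m) (w : \bar R) : 'M[R[i]]_m :=
  map_mx (freq_fun^~ w) M.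

Definition const_tf m (K : 'M[R]_m) : 'M[ratfun]_m :=
  map_mx (fun c : R => (c%:P)%:F) K.

(* Stability of the negative feedback interconnection G # H, H constant. *)
Definition feedback_stable m (G : 'M[ratfun]_m) (H : 'M[R]_m) : Prop :=
  (1%:M + G *m const_tf H \in unitmx) /\
  RHinf (invmx (1%:M + G *m const_tf H)).

Definition posdef m (H : 'M[R]_m) : Prop :=
  H^T = H /\ forall x : 'cV[R]_m, x != 0 -> 0 < (x^T *m H *m x) 0 0.

End TransferMatrices.

Section OperatingPoints.
Variable R : realType.

Definition active_power (O : 'cV[R]_3) : R := O 0 0.
Definition reactive_power (O : 'cV[R]_3) : R := O 1 0.
Definition voltage (O : 'cV[R]_3) : R := O 2%:R 0.

(* The angle of P + jQ is read modulo 2 pi; the origin admits every angle. *)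
Definition has_angle_in (P Q : R) (Psi : set R) : Prop :=
  exists2 t, Psi t &
    P = Num.sqrt (P ^+ 2 + Q ^+ 2) * cos t /\
    Q = Num.sqrt (P ^+ 2 + Q ^+ 2) * sin t.

Definition admissible (kappa : R) (Psi V : set R) : set 'cV[R]_3 :=
  [set O | [/\ active_power O ^+ 2 + reactive_power O ^+ 2 <= kappa ^+ 2,
               has_angle_in (active_power O) (reactive_power O) Psi &
               V (voltage O)]].

End OperatingPoints.

Section ComplexMatrices.
Variable R : realType.
Local Notation C := R[i].

Definition vnorm n (v : 'cV[C]_n) : R := Num.sqrt (\sum_k Normc.normc (v k 0) ^+ 2).

(* v^* A v *)
Definition qform n (A : 'M[C]_n) (v : 'cV[C]_n) : C := (v^t* *m A *m v) 0 0.

Definition singular_values n (A : 'M[C]_n) : set R :=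
  [set s | 0 <= s /\ eigenvalue (A^t* *m A) (s ^+ 2)%:C].

(* For n > 0 the set of singular values is finite and nonempty, so these are
   its maximum and minimum. *)
Definition sigma_max n (A : 'M[C]_n) : R := sup (singular_values A).
Definition sigma_min n (A : 'M[C]_n) : R := inf (singular_values A).

Definition numerical_range n (A : 'M[C]_n) : set C :=
  [set qform A v | v in [set v | vnorm v = 1]].

Definition sectorial n (A : 'M[C]_n) : Prop := ~ numerical_range A 0.

(* [phi] lists, in nonincreasing order, an admissible choice of the phases of
   the sectorial matrix [A]; [phi ord0] and [phi ord_max] are then the largest
   and the smallest phase. *)
Definition phases n (A : 'M[C]_n.+1) (phi : 'I_n.+1 -> R) : Prop :=
  [/\ exists2 T : 'M[C]_n.+1, T \in unitmx &
        A = T^t* *m diag_mx (\row_k (cos (phi k) +i* sin (phi k))) *m T,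
      forall k l : 'I_n.+1, (k <= l)%N -> phi l <= phi k &
      phi ord0 - phi ord_max < pi].

Definition xz_graph n (A : 'M[C]_n) : set (R * R) :=
  [set (complex.Re (qform A v), vnorm (A *m v) ^+ 2) | v in [set v | vnorm v = 1]].

Definition SRG n (A : 'M[C]_n) : set C :=
  [set c | exists v : 'cV[C]_n, [/\ vnorm v = 1,
     complex.Re c = complex.Re (qform A v) & Normc.normc c = vnorm (A *m v)]].

(* Below, [F i] stands for G_i(jw, O_i) and [K] for H^-1. *)
Section Conditions.
Variables (N : nat) (n : 'I_N.+1 -> nat) (m : nat).
Variables (F : forall i, 'M[C]_((n i).+1)) (K : 'M[C]_m).

Definition imax (f : 'I_N.+1 -> R) : R := \big[Num.max/f ord0]_i f i.
Definition imin (f : 'I_N.+1 -> R) : R := \big[Num.min/f ord0]_i f i.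

Definition gain_cond : Prop := imax (fun i => sigma_max (F i)) < sigma_min K.

Definition phase_cond : Prop :=
  (forall i, sectorial (F i)) /\
  exists phi : forall i, 'I_(n i).+1 -> R,
    [/\ forall i, phases (F i) (phi i),
        imax (fun i => phi i ord0) < pi,
        - pi < imin (fun i => phi i ord_max) &
        imax (fun i => phi i ord0) - imin (fun i => phi i ord_max) < pi].

Definition xz_cond : Prop :=
  forall i (tau : R), 0 < tau <= 1 ->
    xz_graph (F i) `&` xz_graph (- (tau^-1)%:C *: K) = set0.

Definition SRG_cond : Prop :=
  forall i (tau : R), 0 < tau <= 1 ->
    SRG (F i) `&` SRG (- (tau^-1)%:C *: K) = set0.

End Conditions.
End ComplexMatrices.

(* Main.v *)
Require Import Defs.
From HB Require Import structures.
From mathcomp Require Import all_boot all_order all_algebra.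
From mathcomp Require Import fingroup perm generic_quotient fraction.
From mathcomp Require Import sesquilinear spectral.
From mathcomp Require Import complex cauchyreals.
From mathcomp Require Import all_classical all_reals.
From mathcomp Require Import trigo.
From mathcomp Require Import ring lra zify.

Set Implicit Arguments.
Unset Strict Implicit.
Unset Printing Implicit Defensive.

Import Order.TTheory GRing.Theory Num.Theory.
Local Open Scope classical_set_scope.
Local Open Scope sesquilinear_scope.
Local Open Scope complex_scope.
Local Open Scope ring_scope.

(** Fix a frequency and write K = H^-1. If det (1 + tau G H) = 0 for some tau in
    (0, 1], then G u = - t K u for some u <> 0 and t = 1 / tau >= 1. Condition 1
    excludes this by comparing norms, condition 2 because, after a rotation by a
    suitable angle, u^* G u lies in the open right half-plane and - t u^* K u in
    the closed left one. For condition 3, let l and L be the extreme eigenvalues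
    of K. A point (x, z) with x^2 <= z avoids the x-z graphs of all - t K with
    t >= 1 only if
      z + (l + L) t x + l L t^2 > 0   for all t >= 1,
    because the chord of the parabola over [-t L, - t l] is attained and sweeps
    the rest of the region as t grows. This condition is affine in (x, z), so it
    passes from the blocks G_i to G, whereas (L - K) (K - l) >= 0 shows that
    G u = - t K u violates it. Condition 4 is condition 3 in other coordinates.

    Hence det (1 + tau G H) has no zero on the extended imaginary axis for tau in
    [0, 1]. Multiplied by a common denominator of G it becomes a polynomial of
    constant degree with coefficients polynomial in tau, which is Hurwitz at
    tau = 0. Its roots cannot cross the axis, so it is Hurwitz at tau = 1. *)

(** * Quadratic forms and spectral bounds *)

Section Vectors.
Variable R : realType.
Local Notation C := R[i].
Local Notation normc := Normc.normc.

(** Replaces [vnorm] in the estimates: without the square root it is additive over blocks and stays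
    within reach of [ring] and [lra]. *)
Definition nsq n (v : 'cV[C]_n) : R := \sum_k normc (v k 0) ^+ 2.

Lemma nsq_ge0 n (v : 'cV[C]_n) : 0 <= nsq v.
Proof. by apply: sumr_ge0 => k _; rewrite sqr_ge0. Qed.

Lemma vnorm_sqr n (v : 'cV[C]_n) : vnorm v ^+ 2 = nsq v.
Proof. by rewrite sqr_sqrtr ?nsq_ge0. Qed.

Lemma vnorm_eq1 n (v : 'cV[C]_n) : nsq v = 1 -> vnorm v = 1.
Proof. by rewrite /vnorm -/(nsq v) => ->; rewrite sqrtr1. Qed.

Lemma sqr_normcE (z : C) : ((normc z ^+ 2)%:C) = z^*%R * z.
Proof. by rewrite mulrC -normCK -rmorphXn. Qed.

Lemma dotvv n (v : 'cV[C]_n) : (v^t* *m v) 0 0 = (nsq v)%:C.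
Proof.
rewrite mxE rmorph_sum; apply: eq_bigr => k _.
by rewrite [RHS]sqr_normcE !mxE.
Qed.

Lemma nsq_eq0 n (v : 'cV[C]_n) : (nsq v == 0) = (v == 0).
Proof.
apply/eqP/eqP => [|->]; last first.
  by rewrite /nsq big1 // => k _; rewrite mxE Normc.normc0 expr0n.
move=> /eqP; rewrite psumr_eq0 => [/allP h|k _]; last exact: sqr_ge0.
apply/matrixP => k j; rewrite ord1 mxE; apply: Normc.eq0_normc.
by apply/eqP; rewrite -sqrf_eq0; apply: h; rewrite mem_index_enum.
Qed.

Lemma nsq_gt0 n (v : 'cV[C]_n) : (0 < nsq v) = (v != 0).
Proof. by rewrite lt_def nsq_eq0 nsq_ge0 andbT. Qed.

Lemma nsqZ n (a : C) (v : 'cV[C]_n) : nsq (a *: v) = normc a ^+ 2 * nsq v.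
Proof.
rewrite /nsq mulr_sumr; apply: eq_bigr => k _.
by rewrite mxE Normc.normcM exprMn.
Qed.

Lemma normc_real (a : R) : normc (a%:C) ^+ 2 = a ^+ 2.
Proof. by rewrite /= expr0n /= addr0 sqr_sqrtr ?sqr_ge0. Qed.

Lemma adjmxM m n p (A : 'M[C]_(m, n)) (B : 'M[C]_(n, p)) :
  (A *m B)^t* = B^t* *m A^t*.
Proof. by rewrite trmx_mul map_mxM. Qed.

Lemma adjmxZ m n (a : C) (A : 'M[C]_(m, n)) : (a *: A)^t* = a^*%R *: A^t*.
Proof. by apply/matrixP => i j; rewrite !mxE rmorphM. Qed.

Lemma adjmxK m n (A : 'M[C]_(m, n)) : (A^t*)^t* = A.
Proof. exact: trmxCK. Qed.

Lemma nsq_mul n p (A : 'M[C]_(p, n)) (v : 'cV[C]_n) :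
  (nsq (A *m v))%:C = (v^t* *m (A^t* *m A) *m v) 0 0.
Proof. by rewrite -dotvv adjmxM !mulmxA. Qed.

Lemma nsq_unitary n (U : 'M[C]_n) (v : 'cV[C]_n) :
  U^t* *m U = 1%:M -> nsq (U *m v) = nsq v.
Proof.
by move=> hU; apply: complexI; rewrite nsq_mul hU mulmx1 dotvv.
Qed.

Lemma qformZ n (A : 'M[C]_n) (a : C) (v : 'cV[C]_n) :
  qform A (a *: v) = (normc a ^+ 2)%:C * qform A v.
Proof.
rewrite /qform adjmxZ -scalemxAl -scalemxAl -scalemxAr scalerA mxE.
by rewrite sqr_normcE.
Qed.

Lemma qform_scale n (A : 'M[C]_n) (a : C) (v : 'cV[C]_n) :
  qform (a *: A) v = a * qform A v.
Proof. by rewrite /qform -scalemxAr -scalemxAl mxE. Qed.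

Lemma nsqD n (w v : 'cV[C]_n) :
  nsq (w + v) = nsq w + 2 * complex.Re ((v^t* *m w) 0 0) + nsq v.
Proof.
rewrite /nsq mxE raddf_sum /= mulr_sumr -!big_split /=.
apply: eq_bigr => k _; rewrite !mxE.
case: (w k 0) => a b; case: (v k 0) => c d /=.
rewrite !sqr_sqrtr ?addr_ge0 ?sqr_ge0 //.
ring.
Qed.

(* The polynomial [t |-> ||A v + t v||^2] is evaluated at
   [t = - Re (v^* A v)]. *)
Lemma qform_le n (A : 'M[C]_n) (v : 'cV[C]_n) :
  nsq v = 1 -> complex.Re (qform A v) ^+ 2 <= nsq (A *m v).
Proof.
move=> v1; set r := complex.Re _.
have := nsq_ge0 (A *m v + (- r)%:C *: v).
rewrite nsqD nsqZ normc_real v1.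
rewrite adjmxZ -scalemxAl mxE mulmxA -/(qform A v).
have -> : complex.Re (((- r)%:C)^*%R * qform A v) = - r * r.
  by rewrite /r; case: (qform A v) => a b /=; ring.
lra.
Qed.

(** Squaring is injective on nonnegative reals, so passing from |c| to |c|^2 loses nothing. *)
Lemma SRG_xz n (A : 'M[C]_n) (c : C) :
  SRG A c <-> xz_graph A (complex.Re c, normc c ^+ 2).
Proof.
split=> [[v [v1 -> ->]]|[v /= v1 [h1 h2]]]; first by exists v.
exists v; split=> //; apply/eqP.
rewrite -(@eqrXn2 _ 2) ?sqrtr_ge0 //; first by rewrite h2.
by case: (c) => a b; exact: sqrtr_ge0.
Qed.

Lemma xz_graph_above n (A : 'M[C]_n) (p : R * R) :
  xz_graph A p -> p.1 ^+ 2 <= p.2.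
Proof.
move=> [v /= v1 <-] /=; rewrite vnorm_sqr qform_le //.
by rewrite -vnorm_sqr v1 expr1n.
Qed.

(** The map c -> (Re c, |c|^2) has image z >= x^2. Every x-z graph lies in that region, so a common
    point of two x-z graphs lifts to a common point of the SRGs. *)
Lemma SRG_xz_disjoint n p (A : 'M[C]_n) (B : 'M[C]_p) :
  SRG A `&` SRG B = set0 <-> xz_graph A `&` xz_graph B = set0.
Proof.
split=> h; rewrite -subset0.
  move=> [x z] [hA hB]; have xz := xz_graph_above hA; rewrite /= in xz.
  pose c := x +i* Num.sqrt (z - x ^+ 2).
  have E : normc c ^+ 2 = z.
    by rewrite /= sqr_sqrtr ?addr_ge0 ?sqr_ge0 // sqr_sqrtr ?subr_ge0 //; ring.
  suff : set0 c by [].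
  by rewrite -h; split; apply/SRG_xz; rewrite E.
move=> c [/SRG_xz hA /SRG_xz hB].
suff : set0 (complex.Re c, normc c ^+ 2) by [].
by rewrite -h.
Qed.

End Vectors.

(** * Spectral theorem and singular value bounds *)

Section Spectral.
Variable R : realType.
Local Notation C := R[i].
Local Notation normc := Normc.normc.

Lemma qform_diag n (T : 'M[C]_n) (d : 'I_n -> C) (v : 'cV[C]_n) :
  qform (T^t* *m diag_mx (\row_k d k) *m T) v =
  \sum_k d k * (normc ((T *m v) k 0) ^+ 2)%:C.
Proof.
have -> : qform (T^t* *m diag_mx (\row_k d k) *m T) v =
  ((T *m v)^t* *m (diag_mx (\row_k d k) *m (T *m v))) 0 0.
  by rewrite /qform adjmxM !mulmxA.
rewrite mul_diag_mx mxE; apply: eq_bigr => k _.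
by rewrite [in RHS]sqr_normcE !mxE mulrCA.
Qed.

Lemma hermitian_diag n (M : 'M[C]_n) : M^t* = M ->
  exists U (d : 'I_n -> R), [/\ U *m U^t* = 1%:M, U^t* *m U = 1%:M &
    M = U^t* *m diag_mx (\row_k (d k)%:C) *m U].
Proof.
move=> hM.
have hh : M \is hermsymmx by apply/is_hermitianmxP; rewrite expr0 scale1r hM.
have /orthomx_spectralP E := hermitian_normalmx hh.
have hr := hermitian_spectral_diag_real hh.
have hU := spectral_unitarymx M.
exists (spectralmx M), (fun k => complex.Re (spectral_diag M 0 k)).
have UU : spectralmx M *m (spectralmx M)^t* = 1%:M by apply/unitarymxP.
split; [exact: UU | exact: mulmx1C UU | rewrite [LHS]E (invmx_unitary hU)].
have -> : spectral_diag M = \row_k (complex.Re (spectral_diag M 0 k))%:C by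
  apply/matrixP => i j; rewrite ord1 mxE RRe_real //; have /mxOverP := hr; apply.
by do 3 f_equal; apply/rowP => k; rewrite !mxE.
Qed.

Lemma hermitian_spectral n (M : 'M[C]_n) : M^t* = M ->
  exists U (d : 'I_n -> R), [/\ U *m U^t* = 1%:M, U^t* *m U = 1%:M,
    forall v, nsq (U *m v) = nsq v,
    forall v, qform M v = (\sum_k d k * normc ((U *m v) k 0) ^+ 2)%:C &
    U *m M = diag_mx (\row_k (d k)%:C) *m U].
Proof.
move=> /hermitian_diag [U [d [U1 U2 E]]]; exists U, d.
split; [exact: U1 | exact: U2 | by move=> v; apply: nsq_unitary | |].
- move=> v; rewrite E qform_diag rmorph_sum; apply: eq_bigr => k _.
  exact/esym/rmorphM.
- by rewrite [in LHS]E !mulmxA U1 mul1mx.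
Qed.

Lemma gram_hermitian n (A : 'M[C]_n) : (A^t* *m A)^t* = A^t* *m A.
Proof. by rewrite adjmxM adjmxK. Qed.

Lemma nsq_qform n (A : 'M[C]_n) v : (nsq (A *m v))%:C = qform (A^t* *m A) v.
Proof. exact: nsq_mul. Qed.

(** Diagonalising A^* A turns ||A v||^2 into a weighted sum of squared coordinates whose weights are
    the squared singular values; both singular value bounds then hold termwise. *)
Lemma gram_spectral n (A : 'M[C]_n) :
  exists U (d : 'I_n -> R), [/\
    forall v, nsq (U *m v) = nsq v,
    forall v, nsq (A *m v) = \sum_k d k * normc ((U *m v) k 0) ^+ 2,
    forall k, 0 <= d k,
    forall k, singular_values A (Num.sqrt (d k)) &
    forall s, singular_values A s -> exists k, s = Num.sqrt (d k)].
Proof.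
have [U [d [U1 U2 hn hq hU]]] := hermitian_spectral (gram_hermitian A).
have hA v : nsq (A *m v) = \sum_k d k * normc ((U *m v) k 0) ^+ 2.
  by apply: complexI; rewrite nsq_qform hq.
have d0 k : 0 <= d k.
  have := nsq_ge0 (A *m (U^t* *m delta_mx k 0)).
  rewrite hA mulmxA U1 mul1mx (bigD1 k) //= big1 => [|j jk].
    by rewrite !mxE !eqxx Normc.normc1 expr1n mulr1 addr0.
  by rewrite mxE (negPf jk) mulr0n Normc.normc0 expr0n mulr0.
exists U, d; split=> // [k|s [s0 /eigenvalueP[x hx x0]]].
  split; first exact: sqrtr_ge0.
  (* [eigenvalue] refers to row vectors, so the eigenvector is a row of U. *)
  rewrite sqr_sqrtr //; apply/eigenvalueP; exists (row k U).
    by rewrite -row_mul hU row_mul row_diag_mx mxE -scalemxAl -rowE.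
  apply: contraTneq isT => r0.
  have := congr1 (row k) U1; rewrite row_mul r0 mul0mx => /matrixP/(_ 0 k).
  by rewrite !mxE eqxx => /esym/eqP; rewrite oner_eq0.
(* In the coordinates y = x U^* the eigenvector equation reads d_k y_k = s^2 y_k, and some y_k is
   nonzero. *)
have y0 : x *m U^t* != 0.
  apply: contraNneq x0 => y0; rewrite -[x]mulmx1 -U2 mulmxA y0 mul0mx //.
have [k yk] : exists k, (x *m U^t*) 0 k != 0.
  apply/existsP; rewrite -negb_forall; apply: contraNN y0 => /forallP h.
  by apply/eqP/matrixP => i j; rewrite ord1 [RHS]mxE; apply/eqP/h.
exists k; have hy : (x *m U^t*) *m diag_mx (\row_k (d k)%:C) =
    (s ^+ 2)%:C *: (x *m U^t*).
  rewrite -[diag_mx _]mulmx1 -U1 !mulmxA -(mulmxA _ _ U) -hU !mulmxA.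
  by rewrite -(mulmxA x) U2 mulmx1 -(mulmxA x) hx -scalemxAl.
move: yk hy; move: (x *m _) => y yk hy.
have := congr1 (fun M : 'rV_n => M 0 k) hy; rewrite mul_mx_diag !mxE mulrC.
move=> /(mulIf yk)/complexI ->.
by rewrite sqrtr_sqr ger0_norm.
Qed.


Lemma sigma_max_ubound n (A : 'M[C]_n) s :
  singular_values A s -> s <= sigma_max A.
Proof.
have [U [d [hn hA d0 hs hs']]] := gram_spectral A.
(* A crude upper bound suffices: the supremum only has to exist. *)
apply: ub_le_sup; exists (\sum_k Num.sqrt (d k)) => r /hs' [k ->].
by rewrite (bigD1 k) //= lerDl sumr_ge0 // => j _; exact: sqrtr_ge0.
Qed.

Lemma sigma_min_lbound n (A : 'M[C]_n) s :
  singular_values A s -> sigma_min A <= s.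
Proof. by apply: ge_inf; exists 0 => r []. Qed.

Lemma sigma_max_ge0 n (A : 'M[C]_n.+1) : 0 <= sigma_max A.
Proof.
have [U [d [_ _ _ hs _]]] := gram_spectral A.
exact: le_trans (sqrtr_ge0 _) (sigma_max_ubound (hs 0)).
Qed.

Lemma sigma_min_ge0 n (A : 'M[C]_n) : 0 <= sigma_min A.
Proof.
have [E|/eqP/set0P S0] := pselect (singular_values A = set0).
  (* The infimum of the empty set is 0 by convention. *)
  by rewrite /sigma_min E inf0.
by apply: lb_le_inf => // s [].
Qed.

Lemma sigma_max_bound n (A : 'M[C]_n) v :
  nsq (A *m v) <= sigma_max A ^+ 2 * nsq v.
Proof.
have [U [d [hn hA d0 hs _]]] := gram_spectral A.
rewrite hA -hn /(nsq (U *m v)) mulr_sumr; apply: ler_sum => k _.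
apply: ler_wpM2r; first exact: sqr_ge0.
have h := sigma_max_ubound (hs k); rewrite -(sqr_sqrtr (d0 k)).
by rewrite ler_pXn2r ?nnegrE ?sqrtr_ge0 // (le_trans _ h) ?sqrtr_ge0.
Qed.

Lemma sigma_min_bound n (A : 'M[C]_n) v :
  sigma_min A ^+ 2 * nsq v <= nsq (A *m v).
Proof.
have [U [d [hn hA d0 hs _]]] := gram_spectral A.
rewrite hA -hn /(nsq (U *m v)) mulr_sumr; apply: ler_sum => k _.
apply: ler_wpM2r; first exact: sqr_ge0.
have h := sigma_min_lbound (hs k); rewrite -(sqr_sqrtr (d0 k)).
by rewrite ler_pXn2r ?nnegrE ?sqrtr_ge0 // sigma_min_ge0.
Qed.
End Spectral.
(** * Frequency-wise regularity *)

Section Blocks.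
Variable R : realType.
Local Notation C := R[i].
Local Notation normc := Normc.normc.
Variables (p : nat) (p_ : 'I_p -> nat).

Lemma dot_blocks (u w : 'cV[C]_(\sum_i p_ i)) :
  (u^t* *m w) 0 0 = \sum_i ((submxcol u i)^t* *m submxcol w i) 0 0.
Proof.
rewrite -{1}[w]submxcolK.
have -> : u^t* = \mxrow_i (submxcol u i)^t*.
  by rewrite -{1}[u]submxcolK; apply/matrixP => i j; rewrite !mxE.
by rewrite mul_mxrow_mxcol summxE.
Qed.

Lemma nsq_blocks (u : 'cV[C]_(\sum_i p_ i)) : nsq u = \sum_i nsq (submxcol u i).
Proof.
apply: complexI; rewrite -dotvv dot_blocks rmorph_sum.
by apply: eq_bigr => i _; rewrite dotvv.
Qed.

Lemma mxdiag_mul (F : forall i, 'M[C]_(p_ i)) (u : 'cV[C]_(\sum_i p_ i)) i :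
  submxcol (mxdiag F *m u) i = F i *m submxcol u i.
Proof.
rewrite -{1}[u]submxcolK /mxdiag mul_mxblock_mxrow mxcolK (bigD1 i) //=.
rewrite eqxx conform_mx_id big1 ?addr0 // => j.
by rewrite eq_sym => /negPf ->; rewrite mul0mx.
Qed.

Lemma nsq_mxdiag (F : forall i, 'M[C]_(p_ i)) (u : 'cV[C]_(\sum_i p_ i)) :
  nsq (mxdiag F *m u) = \sum_i nsq (F i *m submxcol u i).
Proof. by rewrite nsq_blocks; apply: eq_bigr => i _; rewrite mxdiag_mul. Qed.

Lemma qform_mxdiag (F : forall i, 'M[C]_(p_ i)) (u : 'cV[C]_(\sum_i p_ i)) :
  qform (mxdiag F) u = \sum_i qform (F i) (submxcol u i).
Proof.
rewrite /qform -mulmxA dot_blocks; apply: eq_bigr => i _.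
by rewrite mxdiag_mul mulmxA.
Qed.

Lemma submxcol_neq0 (u : 'cV[C]_(\sum_i p_ i)) :
  u != 0 -> exists i, submxcol u i != 0.
Proof.
move=> u0; apply/existsP; rewrite -negb_forall; apply: contraNN u0 => /forallP h.
by apply/eqP/mxcolP => i; rewrite submxcol0; apply/eqP.
Qed.

(** Carries a separating inequality from the blocks to G: zero blocks contribute 0, and a nonzero u
    has a nonzero block. *)
Lemma blocks_sum_gt0 (f : forall i, 'cV[C]_(p_ i) -> R)
  (u : 'cV[C]_(\sum_i p_ i)) :
  (forall i, f i 0 = 0) -> (forall i v, v != 0 -> 0 < f i v) -> u != 0 ->
  0 < \sum_i f i (submxcol u i).
Proof.
move=> f0 fp /submxcol_neq0 [i ui]; rewrite (bigD1 i) //= ltr_wpDr ?fp //.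
apply: sumr_ge0 => j _; have [->|h] := eqVneq (submxcol u j) 0.
  by rewrite f0.
exact/ltW/fp.
Qed.

End Blocks.

(** * Half-planes for the phases and chords for the x-z graphs *)

Section Separation.
Variable R : realType.
Local Notation C := R[i].
Local Notation normc := Normc.normc.

Lemma qform0 n (A : 'M[C]_n) : qform A 0 = 0.
Proof. by rewrite /qform mulmx0 mxE. Qed.

(** The quantity is the real part of e^(-i theta) v^* A v, which equals the sum of cos (phi_k -
    theta) |(T v)_k|^2. *)
Lemma phases_half_plane n (A : 'M[C]_n.+1) phi (theta : R) v :
  phases A phi -> (forall k, 0 < cos (phi k - theta)) -> v != 0 ->
  0 < cos theta * complex.Re (qform A v) + sin theta * complex.Im (qform A v).
Proof.
move=> [[T Tu ->] _ _] hc v0; rewrite qform_diag !raddf_sum /= !mulr_sumr -big_split /=.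
have -> : \sum_i (cos theta * complex.Re ((cos (phi i) +i* sin (phi i)) *
            (normc ((T *m v) i 0) ^+ 2)%:C) +
            sin theta * complex.Im ((cos (phi i) +i* sin (phi i)) *
            (normc ((T *m v) i 0) ^+ 2)%:C)) =
          \sum_i cos (phi i - theta) * normc ((T *m v) i 0) ^+ 2.
  by apply: eq_bigr => i _; rewrite cosB /=; ring.
have w0 : T *m v != 0.
  by apply: contraNneq v0 => w0; rewrite -(mulKmx Tu v) w0 mulmx0.
have [k wk] : exists k, (T *m v) k 0 != 0.
  apply/existsP; rewrite -negb_forall; apply: contraNN w0 => /forallP h.
  by apply/eqP/matrixP => i j; rewrite ord1 [RHS]mxE; apply/eqP/h.
rewrite (bigD1 k) //= ltr_wpDr //.
  by apply: sumr_ge0 => j _; rewrite mulr_ge0 ?sqr_ge0 // ltW.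
rewrite mulr_gt0 // exprn_gt0 // lt_def; apply/andP; split.
  by apply: contraNneq wk => /Normc.eq0_normc ->.
by case: ((T *m v) k 0) => a b; exact: sqrtr_ge0.
Qed.

(* [theta] is the midpoint of [a] and [b], clamped to [-pi/2, pi/2]. *)
Lemma phase_sector (a b : R) : - pi < a -> b < pi -> b - a < pi -> a <= b ->
  exists2 theta : R, 0 <= cos theta &
    forall x, a <= x <= b -> 0 < cos (x - theta).
Proof.
move=> ha hb hab leab.
suff [th [h1 h2 h3 h4]] : exists th : R, [/\ - (pi / 2) <= th, th <= pi / 2,
    b - pi / 2 < th & th < a + pi / 2].
  exists th => [|x /andP[ax xb]]; first by apply: cos_ge0_pihalf; rewrite h1 h2.
  by apply: cos_gt0_pihalf; apply/andP; split; lra.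
have [h|h] := leP (pi / 2) ((a + b) / 2).
  by exists (pi / 2); split; lra.
have [h'|h'] := leP ((a + b) / 2) (- (pi / 2)).
  by exists (- (pi / 2)); split; lra.
by exists ((a + b) / 2); split; lra.
Qed.

(* At abscissa [q] the chord of the parabola over [s l, s L] descends to the
   parabola as [s] increases to [q / l]; [s] is the larger root of the equation
   saying that it passes through [(q, z)]. *)
Lemma chord_scaling (l L t q z : R) : 0 < l -> l <= L -> 1 <= t ->
  q ^+ 2 <= z -> z <= (l + L) * t * q - l * L * t ^+ 2 ->
  exists s, [/\ t <= s, l * s <= q, q <= L * s &
    z = (l + L) * s * q - l * L * s ^+ 2].
Proof.
move=> l0 lL t1 qz zt.
have L0 : 0 < L by exact: lt_le_trans lL.
have lL0 : 0 < l * L by exact: mulr_gt0.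
(* The two bounds on z give (q - t l) (t L - q) >= 0, and a nonpositive q would make this product
   negative. *)
have q0 : 0 < q.
  have : 0 <= (q - t * l) * (t * L - q) by lra.
  have : t * l <= t * L by rewrite ler_pM2l //; lra.
  have tl : 0 < t * l by rewrite mulr_gt0 //; lra.
  move=> tlL h; rewrite ltNge; apply/negP => qn.
  have : (q - t * l) * (t * L - q) < 0 by rewrite nmulr_rlt0; lra.
  lra.
(* Discriminant of l L s^2 - (l + L) q s + z. *)
set D := (l + L) ^+ 2 * q ^+ 2 - 4 * (l * L) * z.
have hD : (2 * (l * L) * t - (l + L) * q) ^+ 2 <= D.
  rewrite /D -subr_ge0.
  have -> : (l + L) ^+ 2 * q ^+ 2 - 4 * (l * L) * z -
    (2 * (l * L) * t - (l + L) * q) ^+ 2 =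
    4 * (l * L) * ((l + L) * t * q - l * L * t ^+ 2 - z) by ring.
  by rewrite mulr_ge0 //; lra.
have D0 : 0 <= D by apply: le_trans hD; exact: sqr_ge0.
have hr : Num.sqrt D ^+ 2 = D by rewrite sqr_sqrtr.
have r0 := sqrtr_ge0 D; set r := Num.sqrt D in hr r0.
(* This bound on r amounts to t <= s; the next one, which uses q^2 <= z, amounts to l s <= q. *)
have r1 : 2 * (l * L) * t - (l + L) * q <= r.
  have [h|h] := leP (2 * (l * L) * t - (l + L) * q) 0; first lra.
  by rewrite -(@ler_pXn2r _ 2) ?nnegrE //; [rewrite hr | exact: ltW].
have r2 : r <= (L - l) * q.
  have h0 : 0 <= (L - l) * q by rewrite mulr_ge0 //; lra.
  rewrite -(@ler_pXn2r _ 2) ?nnegrE // hr /D -subr_ge0.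
  have -> : ((L - l) * q) ^+ 2 - ((l + L) ^+ 2 * q ^+ 2 - 4 * (l * L) * z) =
    4 * (l * L) * (z - q ^+ 2) by ring.
  by rewrite mulr_ge0 //; lra.
exists (((l + L) * q + r) / (2 * (l * L))); split.
- by rewrite ler_pdivlMr; lra.
- have -> : l * (((l + L) * q + r) / (2 * (l * L))) = ((l + L) * q + r) / (2 * L).
    by field; rewrite ?gt_eqF.
  by rewrite ler_pdivrMr; lra.
- have -> : L * (((l + L) * q + r) / (2 * (l * L))) = ((l + L) * q + r) / (2 * l).
    by field; rewrite ?gt_eqF.
  rewrite ler_pdivlMr; last lra.
  have : l * q <= L * q by rewrite ler_pM2r.
  lra.
- have -> : z = ((l + L) ^+ 2 * q ^+ 2 - r ^+ 2) / (4 * (l * L)).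
    by rewrite hr /D; field; rewrite ?gt_eqF.
  by field; rewrite ?gt_eqF.
Qed.

(** Positivity is in the partial order of the complex numbers, so it includes that the form is
    real. *)
Definition hposdef n (K : 'M[C]_n) :=
  K^t* = K /\ forall v : 'cV_n, v != 0 -> 0 < qform K v.

(* The points of [xz_graph K] lie below the chord of the parabola [z = x^2] over
   [[l, L]], and every point of that chord is attained. *)
Lemma hposdef_chord n (K : 'M[C]_n.+1) : hposdef K ->
  exists l L : R, [/\ 0 < l, l <= L,
    forall v,
      nsq (K *m v) - (l + L) * complex.Re (qform K v) + l * L * nsq v <= 0 &
    forall x, l <= x <= L -> exists v,
      [/\ nsq v = 1, complex.Re (qform K v) = x &
      nsq (K *m v) = (l + L) * x - l * L]].
Proof.
move=> [Kh Kp].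
have [U [d [U1 U2 hn hq hU]]] := hermitian_spectral Kh.
have hK v : nsq (K *m v) = \sum_k d k ^+ 2 * normc ((U *m v) k 0) ^+ 2.
  rewrite -hn mulmxA hU -mulmxA mul_diag_mx; apply: eq_bigr => k _.
  by rewrite !mxE Normc.normcM exprMn normc_real.
have hq' v : complex.Re (qform K v) = \sum_k d k * normc ((U *m v) k 0) ^+ 2.
  by rewrite hq.
have h1 v : nsq v = \sum_k normc ((U *m v) k 0) ^+ 2 by rewrite -hn.
have UK (w : 'cV_n.+1) : U *m (U^t* *m w) = w by rewrite mulmxA U1 mul1mx.
have unit_sum k (f : 'I_n.+1 -> R) :
    \sum_j f j * normc ((delta_mx k 0 : 'cV[C]_n.+1) j 0) ^+ 2 = f k.
  rewrite (bigD1 k) //= big1 => [|j jk].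
    by rewrite mxE !eqxx Normc.normc1 expr1n mulr1 addr0.
  by rewrite mxE (negPf jk) mulr0n Normc.normc0 expr0n mulr0.
have unit_nsq k : nsq (U^t* *m (delta_mx k 0 : 'cV[C]_n.+1)) = 1.
  rewrite h1 UK -[RHS](unit_sum k (fun=> 1)).
  by apply: eq_bigr => j _; rewrite mul1r.
have dp k : 0 < d k.
  have v0 : U^t* *m (delta_mx k 0 : 'cV[C]_n.+1) != 0.
    by rewrite -nsq_eq0 unit_nsq oner_eq0.
  by have := Kp _ v0; rewrite hq UK unit_sum -(rmorph0 (real_complex R)) ltcR.
have [i _ hi] := @arg_minP _ R _ (0 : 'I_n.+1) xpredT d isT.
have [j _ hj] := @arg_maxP _ R _ (0 : 'I_n.+1) xpredT d isT.
exists (d i), (d j); split=> //; first exact: hi.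
  move=> v; rewrite hK hq' h1 !mulr_sumr -sumrB -big_split /=.
  apply: sumr_le0 => k _.
  have -> : d k ^+ 2 * normc ((U *m v) k 0) ^+ 2 -
    (d i + d j) * (d k * normc ((U *m v) k 0) ^+ 2) +
    d i * d j * normc ((U *m v) k 0) ^+ 2 =
    - ((d k - d i) * (d j - d k)) * normc ((U *m v) k 0) ^+ 2 by ring.
  rewrite mulNr oppr_le0 mulr_ge0 ?sqr_ge0 // mulr_ge0 // subr_ge0.
    exact: hi.
  exact: hj.
move=> x /andP[ix xj].
(* If the extreme eigenvalues agree, the chord is one point, and the weights used below would divide
   by 0. *)
have [E|ne] := eqVneq (d i) (d j).
  have -> : x = d i by apply/eqP; rewrite eq_le ix E xj.
  exists (U^t* *m delta_mx i 0); split=> //; first by rewrite hq' UK unit_sum.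
  by rewrite hK UK unit_sum -E; ring.
have ltij : d i < d j by rewrite lt_neqAle ne hi.
have neij : i != j by apply: contra_neq ne => ->.
(* Convex weights with a d_i + b d_j = x. They are the squared coordinates of a unit vector in the
   span of the two extreme eigenvectors. *)
pose a := (d j - x) / (d j - d i); pose b := (x - d i) / (d j - d i).
have a0 : 0 <= a by rewrite divr_ge0 ?subr_ge0 // ltW.
have b0 : 0 <= b by rewrite divr_ge0 ?subr_ge0 // ltW.
pose w : 'cV[C]_n.+1 :=
  (Num.sqrt a)%:C *: delta_mx i 0 + (Num.sqrt b)%:C *: delta_mx j 0.
have two_sum (f : 'I_n.+1 -> R) :
    \sum_k f k * normc (w k 0) ^+ 2 = f i * a + f j * b.
  rewrite (bigD1 i) //= (bigD1 j) /=; last by rewrite eq_sym.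
  rewrite big1 => [|k /andP[ki kj]]; last first.
    by rewrite !mxE (negPf ki) (negPf kj) !mulr0n !mulr0 addr0 Normc.normc0 expr0n mulr0.
  rewrite !mxE !eqxx (negPf neij) eq_sym (negPf neij) !mulr0n !mulr1n.
  by rewrite !mulr1 !mulr0 addr0 add0r !normc_real !sqr_sqrtr // addr0.
exists (U^t* *m w); split.
- rewrite h1 UK.
  have -> : \sum_k normc (w k 0) ^+ 2 = \sum_k 1 * normc (w k 0) ^+ 2.
    by apply: eq_bigr => k _; rewrite mul1r.
  by rewrite (two_sum (fun=> 1)) /a /b; field; rewrite subr_eq0 gt_eqF.
- by rewrite hq' UK two_sum /a /b; field; rewrite subr_eq0 gt_eqF.
- by rewrite hK UK (two_sum (fun k => d k ^+ 2)) /a /b; field; rewrite subr_eq0 gt_eqF.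
Qed.

(** If the inequality failed, the point of A would lie on or below the chord for - t K, hence on the
    chord for - s K with some s >= t. That point is attained by - s K, contradicting separation at
    tau = 1 / s. *)
Lemma xz_separation n m (A : 'M[C]_n) (K : 'M[C]_m) (l L : R) :
  0 < l -> l <= L ->
  (forall x, l <= x <= L -> exists v,
      [/\ nsq v = 1, complex.Re (qform K v) = x &
      nsq (K *m v) = (l + L) * x - l * L]) ->
  (forall tau, 0 < tau <= 1 ->
    xz_graph A `&` xz_graph (- (tau^-1)%:C *: K) = set0) ->
  forall v t, v != 0 -> 1 <= t ->
  0 < nsq (A *m v) + (l + L) * t * complex.Re (qform A v) +
      l * L * t ^+ 2 * nsq v.
Proof.
move=> l0 lL chord sep v t v0 t1.
(* The inequality is homogeneous of degree 2 in v. *)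
wlog v1 : v v0 / nsq v = 1.
  move=> hw; have nv : 0 < nsq v by rewrite nsq_gt0.
  pose c := (Num.sqrt (nsq v))^-1.
  have c2 : c ^+ 2 = (nsq v)^-1 by rewrite exprVn sqr_sqrtr // ltW.
  have cv : nsq (c%:C *: v) = 1 by rewrite nsqZ normc_real c2 mulVf // gt_eqF.
  have /(_ _ cv) := hw (c%:C *: v).
  rewrite -nsq_eq0 cv oner_eq0 => /(_ isT).
  rewrite -scalemxAr nsqZ qformZ normc_real c2.
  have -> : complex.Re (((nsq v)^-1)%:C * qform A v) =
     (nsq v)^-1 * complex.Re (qform A v).
    by case: (qform A v) => a b /=; ring.
  move=> h; rewrite -(pmulr_rgt0 _ (x := (nsq v)^-1)) ?invr_gt0 //.
  suff <- : (nsq v)^-1 * nsq (A *m v) +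
    (l + L) * t * ((nsq v)^-1 * complex.Re (qform A v)) + l * L * t ^+ 2 * 1 = 
    (nsq v)^-1 * (nsq (A *m v) + (l + L) * t * complex.Re (qform A v) +
    l * L * t ^+ 2 * nsq v) by [].
  by field; rewrite gt_eqF.
rewrite v1 mulr1 ltNge; apply/negP => hle.
(* The abscissa is mirrored, q = - Re (v^* A v), so that [chord_scaling] deals with s K instead of -
   s K. *)
have hz : nsq (A *m v) <= (l + L) * t * (- complex.Re (qform A v)) - l * L * t ^+ 2.
  by lra.
have qz : (- complex.Re (qform A v)) ^+ 2 <= nsq (A *m v) by rewrite sqrrN qform_le.
have [s [ts ls sL zE]] := chord_scaling l0 lL t1 qz hz.
have s0 : 0 < s by lra.
have [|u [u1 uq uz]] := chord (- complex.Re (qform A v) / s).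
  by rewrite ler_pdivlMr // ler_pdivrMr // ls sL.
have := sep s^-1; rewrite invr_gt0 s0 invf_le1 // (le_trans t1 ts) => /(_ isT).
rewrite -subset0 invrK => /(_ (complex.Re (qform A v), nsq (A *m v))); apply; split.
  by exists v; rewrite /= ?vnorm_sqr // vnorm_eq1.
exists u; first exact: vnorm_eq1.
rewrite /= vnorm_sqr qform_scale -scalemxAl nsqZ -rmorphN normc_real uz.
congr pair.
  have -> : complex.Re ((- s)%:C * qform K u) = - s * complex.Re (qform K u).
    by case: (qform K u) => a b /=; ring.
  by rewrite uq; field; rewrite gt_eqF.
by rewrite zE; field; rewrite gt_eqF.
Qed.

End Separation.

(** * Positive definiteness over the complex numbers *)

Section PosDef.
Variable R : realType.
Local Notation C := R[i].

Lemma posdef_unit n (H : 'M[R]_n) : posdef H -> H \in unitmx.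
Proof.
move=> [hs hp]; rewrite unitmxE unitfE -det_tr; apply/det0P => -[x x0 hx].
have := hp x^T; rewrite trmx_eq0 trmxK => /(_ x0).
by rewrite -{1}hs hx mul0mx mxE ltxx.
Qed.

(** For v = a + i b, symmetry of H cancels the mixed terms and leaves v^* H v = a^T H a + b^T H
    b. *)
Lemma posdef_hposdef n (H : 'M[R]_n) :
  posdef H -> hposdef (map_mx (real_complex R) H).
Proof.
move=> [hs hp]; split.
  apply/matrixP => i j; rewrite !mxE -[in RHS]hs mxE.
  exact: conjc_real.
move=> v v0.
pose a := map_mx (@complex.Re R) v; pose b := map_mx (@complex.Im R) v.
have quad (x : 'cV[R]_n) :
    (x^T *m H *m x) 0 0 = \sum_j \sum_i x i 0 * H i j * x j 0.
  rewrite mxE; apply: eq_bigr => j _; rewrite mxE mulr_suml.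
  by apply: eq_bigr => i _; rewrite mxE.
have hRe : complex.Re (qform (map_mx (real_complex R) H) v) =
    (a^T *m H *m a) 0 0 + (b^T *m H *m b) 0 0.
  rewrite !quad /qform mxE raddf_sum -big_split; apply: eq_bigr => j _.
  rewrite mxE mulr_suml raddf_sum -big_split; apply: eq_bigr => i _ /=.
  rewrite !mxE; case: (v i 0) => x y; case: (v j 0) => z t /=.
  ring.
have hIm : complex.Im (qform (map_mx (real_complex R) H) v) = 0.
  have qE : complex.Im (qform (map_mx (real_complex R) H) v) =
      \sum_j \sum_i (a i 0 * H i j * b j 0 - b i 0 * H i j * a j 0).
    rewrite /qform mxE raddf_sum; apply: eq_bigr => j _.
    rewrite mxE mulr_suml raddf_sum; apply: eq_bigr => i _ /=.
    rewrite !mxE; case: (v i 0) => x y; case: (v j 0) => z t /=.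
    ring.
  rewrite qE; under eq_bigr do rewrite sumrB.
  rewrite sumrB exchange_big /=; apply/eqP; rewrite subr_eq0; apply/eqP.
  apply: eq_bigr => j _; apply: eq_bigr => i _.
  have -> : H j i = H i j by rewrite -[in LHS]hs mxE.
  by ring.
rewrite ltcE hIm hRe /= eqxx /=.
have sq_ge0 (x : 'cV[R]_n) : 0 <= (x^T *m H *m x) 0 0.
  have [->|x0] := eqVneq x 0; first by rewrite mulmx0 mxE.
  exact/ltW/hp.
have [a0|a0] := eqVneq a 0; last by rewrite ltr_pwDl // hp.
rewrite ltr_wpDl // hp //; apply: contraNneq v0 => b0.
apply/eqP/matrixP => i j; rewrite ord1 mxE; apply/eqP; rewrite eq_complex /=.
have := congr1 (fun M : 'cV_n => M i 0) a0; rewrite !mxE => ->.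
by have := congr1 (fun M : 'cV_n => M i 0) b0; rewrite !mxE => ->; rewrite eqxx.
Qed.

(** With w = K v one has v^* K v = w^* H w. *)
Lemma hposdef_inv n (H K : 'M[C]_n) : hposdef H -> H *m K = 1%:M -> hposdef K.
Proof.
move=> [hs hp] HK; have KH := mulmx1C HK.
have Kh : K^t* = K.
  rewrite -[LHS]mulmx1 -HK mulmxA -[in X in X *m K]hs -adjmxM HK.
  by rewrite trmx1 map_mx1 mul1mx.
split; first exact: Kh.
move=> v v0.
have w0 : K *m v != 0.
  by apply: contraNneq v0 => w0; rewrite -(mul1mx v) -HK -mulmxA w0 mulmx0.
by have := hp _ w0; rewrite /qform adjmxM Kh -!mulmxA (mulmxA H) HK mul1mx.
Qed.

End PosDef.

(** * Each of the four conditions excludes G u = - t K u *)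

Section FrequencyCondition.
Variable R : realType.
Local Notation C := R[i].
Local Notation normc := Normc.normc.
Variables (N : nat) (n : 'I_N.+1 -> nat).
Local Notation m := (\sum_i (n i).+1)%N.
Variables (F : forall i, 'M[C]_((n i).+1)) (K : 'M[C]_m).

Lemma le_imax (f : 'I_N.+1 -> R) i : f i <= imax f.
Proof. by rewrite /imax (bigD1 i) //= le_max lexx. Qed.

Lemma imin_le (f : 'I_N.+1 -> R) i : imin f <= f i.
Proof. by rewrite /imin (bigD1 i) //= ge_min lexx. Qed.

Lemma SRG_condP : SRG_cond F K <-> xz_cond F K.
Proof. by split=> h i tau ht; apply/SRG_xz_disjoint; exact: h. Qed.

Local Notation G := (mxdiag (p_ := fun i => (n i).+1) F).

Lemma gain_regular (u : 'cV[C]_m) t : gain_cond F K -> u != 0 -> 1 <= t ->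
  G *m u != - t%:C *: (K *m u).
Proof.
move=> hg u0 t1; apply/eqP => E.
have /(congr1 (@nsq R _)) := E; rewrite nsqZ -rmorphN normc_real sqrrN => nE.
have h1 : nsq (G *m u) <= imax (fun i => sigma_max (F i)) ^+ 2 * nsq u.
  rewrite nsq_mxdiag nsq_blocks mulr_sumr; apply: ler_sum => i _.
  apply: le_trans (sigma_max_bound _ _) _.
  apply: ler_wpM2r; first exact: nsq_ge0.
  rewrite ler_pXn2r ?nnegrE ?sigma_max_ge0 ?(le_imax (fun i => sigma_max (F i))) //.
  exact: le_trans (sigma_max_ge0 (F i)) (le_imax (fun i => sigma_max (F i)) i).
have h2 := sigma_min_bound K u.
have b0 : 0 <= imax (fun i => sigma_max (F i)).
  exact: le_trans (sigma_max_ge0 (F 0)) (le_imax (fun i => sigma_max (F i)) 0).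
have h3 : imax (fun i => sigma_max (F i)) ^+ 2 * nsq u < sigma_min K ^+ 2 * nsq u.
  by rewrite ltr_pM2r ?nsq_gt0 // ltr_pXn2r ?nnegrE // (le_trans b0) // ltW.
have h4 : nsq (K *m u) <= t ^+ 2 * nsq (K *m u).
  by rewrite ler_peMl ?nsq_ge0 // exprn_ege1.
by have := lt_le_trans (le_lt_trans h1 h3) (le_trans h2 h4); rewrite nE ltxx.
Qed.

Lemma qform_eqN (u : 'cV[C]_m) t :
  G *m u = - t%:C *: (K *m u) -> qform G u = - t%:C * qform K u.
Proof.
by move=> E; rewrite /qform -!mulmxA E -scalemxAr mxE.
Qed.

Lemma phase_regular (u : 'cV[C]_m) t :
  hposdef K -> phase_cond F -> u != 0 -> 1 <= t ->
  G *m u != - t%:C *: (K *m u).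
Proof.
move=> [Kh Kp] [_ [phi [hphi hmax hmin hd]]] u0 t1; apply/eqP => E.
set b := imax _ in hmax hd; set a := imin _ in hmin hd.
have hi i k : a <= phi i k <= b.
  have [_ mono _] := hphi i; apply/andP; split.
    by apply: le_trans (imin_le (fun i => phi i ord_max) i) _; apply: mono; rewrite -ltnS.
  by apply: le_trans _ (le_imax (fun i => phi i ord0) i); apply: mono.
have leab : a <= b by have /andP[h1 h2] := hi 0 0; exact: le_trans h2.
have [th c0 hc] := phase_sector hmin hmax hd leab.
(* One angle serves all blocks. The sum of the f_i over the blocks of u is positive, but G u = - t K
   u makes it - t cos(th) u^* K u <= 0. *)
pose f i (v : 'cV_(n i).+1) :=
  cos th * complex.Re (qform (F i) v) + sin th * complex.Im (qform (F i) v).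
have f0 i : f i 0 = 0 by rewrite /f qform0 !mulr0 addr0.
have fp i v : v != 0 -> 0 < f i v.
  by move=> v0; apply: phases_half_plane (hphi i) _ v0 => k; exact: hc.
have := blocks_sum_gt0 f0 fp u0; rewrite /f.
rewrite big_split /= -!mulr_sumr -!raddf_sum /= -qform_mxdiag (qform_eqN E).
have := Kp _ u0; rewrite ltcE; case: (qform K u) => x y /= /andP[/eqP -> x0].
have -> : cos th * (- t * x - - 0 * 0) + sin th * (- t * 0 + - 0 * x) =
  - (cos th * t * x) by ring.
by rewrite oppr_gt0 ltNge !mulr_ge0 // ?(ltW x0) // (le_trans ler01).
Qed.

(** [hposdef_chord] needs a positive dimension in order to pick extreme eigenvalues. *)
Lemma dim_succ : exists m', m = m'.+1.
Proof. by exists m.-1; rewrite prednK // big_ord_recl. Qed.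

Lemma xz_regular (u : 'cV[C]_m) t :
  hposdef K -> xz_cond F K -> u != 0 -> 1 <= t ->
  G *m u != - t%:C *: (K *m u).
Proof.
move=> Kp hx u0 t1; apply/eqP => E.
have [l [L [l0 lL below chord]]] : exists l L : R, [/\ 0 < l, l <= L,
    forall v,
      nsq (K *m v) - (l + L) * complex.Re (qform K v) + l * L * nsq v <= 0 &
    forall x, l <= x <= L -> exists v,
      [/\ nsq v = 1, complex.Re (qform K v) = x &
      nsq (K *m v) = (l + L) * x - l * L]].
  have [m' Em] := dim_succ; move: (K) Kp; rewrite Em; exact: hposdef_chord.
pose f i (v : 'cV_(n i).+1) := nsq (F i *m v) +
  (l + L) * t * complex.Re (qform (F i) v) + l * L * t ^+ 2 * nsq v.
have f0 i : f i 0 = 0.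
  have z0 k : nsq (0 : 'cV[C]_k) = 0 by apply/eqP; rewrite nsq_eq0.
  by rewrite /f mulmx0 qform0 !z0 !mulr0 !addr0.
have fp i v : v != 0 -> 0 < f i v.
  by move=> v0; apply: xz_separation l0 lL chord _ _ _ v0 t1; exact: hx.
have := blocks_sum_gt0 f0 fp u0; rewrite /f.
rewrite !big_split /= -!mulr_sumr -!raddf_sum /= -qform_mxdiag (qform_eqN E).
rewrite -nsq_blocks -nsq_mxdiag E nsqZ -rmorphN normc_real sqrrN.
have -> : complex.Re ((- t)%:C * qform K u) = - t * complex.Re (qform K u).
  by case: (qform K u) => x y /=; ring.
(* On G u = - t K u the separation form collapses to t^2 times the chord form of K, which is
   nonpositive. *)
have -> : t ^+ 2 * nsq (K *m u) + (l + L) * t * (- t * complex.Re (qform K u)) +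
    l * L * t ^+ 2 * nsq u =
    t ^+ 2 * (nsq (K *m u) - (l + L) * complex.Re (qform K u) + l * L * nsq u) by ring.
rewrite pmulr_rgt0; last by rewrite exprn_gt0 //; lra.
by rewrite ltNge below.
Qed.

(** A kernel vector x of 1 + tau G H gives u = H x with x = K u and G u = - (1 / tau) K u. The
    determinant is transposed because [det0P] produces row vectors. *)
Lemma frequency_regular (H : 'M[R]_m) (tau : R) :
  posdef H -> K = map_mx (real_complex R) (invmx H) ->
  [\/ gain_cond F K, phase_cond F, xz_cond F K | SRG_cond F K] -> 0 < tau <= 1 ->
  \det (1%:M + tau%:C *: (G *m map_mx (real_complex R) H)) != 0.
Proof.
move=> hH KE hF /andP[tau0 tau1].
have Hu := posdef_unit hH.
have HK : map_mx (real_complex R) H *m K = 1%:M.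
  by rewrite KE -map_mxM mulmxV // map_mx1.
have Kp := hposdef_inv (posdef_hposdef hH) HK.
rewrite -det_tr; apply/det0P => -[x x0 /(congr1 trmx)].
rewrite trmx_mul trmxK trmx0 => hx.
pose u := map_mx (real_complex R) H *m x^T.
have xE : x^T = K *m u by rewrite /u mulmxA (mulmx1C HK) mul1mx.
have u0 : u != 0.
  by apply: contraNneq x0 => u0; rewrite -trmx_eq0 xE u0 mulmx0.
have E : G *m u = - (tau^-1)%:C *: (K *m u).
  move: hx; rewrite mulmxDl mul1mx -scalemxAl -mulmxA -/u xE => /eqP.
  rewrite addrC addr_eq0 => /eqP/(congr1 (fun M => (tau^-1)%:C *: M)).
  rewrite scalerA -rmorphM mulVf ?gt_eqF // rmorph1 scale1r => ->.
  by rewrite scalerN scaleNr.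
have t1 : 1 <= tau^-1 by rewrite invf_ge1.
have /eqP[] : G *m u != - (tau^-1)%:C *: (K *m u).
  case: hF => h; first exact: gain_regular.
  - exact: phase_regular.
  - exact: xz_regular.
  - by apply: xz_regular => //; apply/SRG_condP.
exact: E.
Qed.

End FrequencyCondition.
(** * Homotopy of Hurwitz polynomials *)

Section Homotopy.
Variable R : realType.
Local Notation C := R[i].
Local Notation normc := Normc.normc.
Implicit Types (p : {poly C}) (s r : C).

Definition hurwitz p := forall s, root p s -> complex.Re s < 0.

Lemma normc_ge0 s : 0 <= normc s.
Proof. by case: s => a b; exact: sqrtr_ge0. Qed.

Lemma normcX s n : normc (s ^+ n) = normc s ^+ n.
Proof.
elim: n => [|n IH]; first by rewrite !expr0 Normc.normc1.
by rewrite !exprS Normc.normcM IH.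
Qed.

Lemma normc_gt0 s : (0 < normc s) = (s != 0).
Proof.
rewrite lt_def normc_ge0 andbT; congr negb; apply/eqP/eqP => [|->].
  exact: Normc.eq0_normc.
exact: Normc.normc0.
Qed.

Lemma normc_rc (a : R) : normc a%:C = `|a|.
Proof. by rewrite /= expr0n /= addr0 sqrtr_sqr. Qed.

Lemma ReleNormc s : complex.Re s <= normc s.
Proof.
case: s => a b /=; apply: le_trans (ler_norm a) _.
by rewrite -sqrtr_sqr ler_wsqrtr // lerDl sqr_ge0.
Qed.

Lemma normc_sum (I : Type) (l : seq I) (f : I -> C) :
  normc (\sum_(i <- l) f i) <= \sum_(i <- l) normc (f i).
Proof.
elim: l => [|i l IH]; first by rewrite !big_nil Normc.normc0.
by rewrite !big_cons; apply: le_trans (le_normcD _ _) _; rewrite lerD2l.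
Qed.

(** With d = - Re r, both d <= |s - r| and |s| - |r| <= |s - r| hold. Adding 1 + |r| copies of the
    first to d copies of the second gives the constant. *)
Lemma normc_sub_lower r : complex.Re r < 0 -> exists2 k : R, 0 < k &
  forall s, 0 <= complex.Re s -> k * (1 + normc s) <= normc (s - r).
Proof.
move=> r0; pose d := - complex.Re r; have d0 : 0 < d by rewrite oppr_gt0.
have nr := normc_ge0 r.
have D0 : 0 < d + 1 + normc r by lra.
exists (d / (d + 1 + normc r)) => [|s s0]; first by rewrite divr_gt0.
rewrite mulrAC ler_pdivrMr //.
have h1 : d <= normc (s - r).
  by apply: le_trans (ReleNormc _); rewrite /d; case: (s) (r) s0 => [a b] [x y] /=; lra.
have h2 : normc s <= normc (s - r) + normc r by rewrite -{1}(subrK r s) le_normcD.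
have h3 : d * (normc (s - r) + normc r + 1) <= normc (s - r) * (d + 1 + normc r).
  have : d * (normc r + 1) <= normc (s - r) * (normc r + 1) by rewrite ler_pM2r //; lra.
  lra.
apply: le_trans _ h3; rewrite ler_pM2l //; lra.
Qed.

Lemma hurwitz_factor p : hurwitz p -> p != 0 -> exists rs : seq C,
  [/\ (size p).-1 = size rs, all (fun r => complex.Re r < 0) rs &
    forall s, p.[s] = lead_coef p * \prod_(r <- rs) (s - r)].
Proof.
move=> hp p0; have [rs pE] := closed_field_poly_normal p.
have l0 : lead_coef p != 0 by rewrite lead_coef_eq0.
exists rs; split.
- by rewrite pE size_scale // size_prod_XsubC.
- apply/allP => r rrs; apply: hp; rewrite pE rootZ // root_prod_XsubC.
  exact: rrs.
- move=> s; rewrite {1}pE hornerZ horner_prod; congr (_ * _).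
  by apply: eq_bigr => r _; rewrite hornerXsubC.
Qed.

(* The factor [(1 + normc s) ^+ _] makes the bound absorb perturbations of all
   coefficients at once, so no a priori bound on the roots is needed. *)
Lemma hurwitz_lower p : hurwitz p -> p != 0 -> exists2 k : R, 0 < k &
  forall s, 0 <= complex.Re s -> k * (1 + normc s) ^+ (size p).-1 <= normc p.[s].
Proof.
move=> hp p0; have [rs [-> rs0 pE]] := hurwitz_factor hp p0.
have l0 : 0 < normc (lead_coef p) by rewrite normc_gt0 lead_coef_eq0.
suff [k k0 hk] : exists2 k : R, 0 < k & forall s, 0 <= complex.Re s ->
    k * (1 + normc s) ^+ (size rs) <= normc (\prod_(r <- rs) (s - r)).
  exists (normc (lead_coef p) * k) => [|s s0]; first exact: mulr_gt0.
  by rewrite pE Normc.normcM -mulrA ler_pM2l // hk.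
elim: rs rs0 {pE} => [|r rs IH] /= => [_|/andP[r0 /IH [k k0 hk]]].
  by exists 1 => // s _; rewrite big_nil Normc.normc1 expr0 mulr1.
have [k' k'0 hk'] := normc_sub_lower r0.
exists (k' * k) => [|s s0]; first exact: mulr_gt0.
rewrite big_cons Normc.normcM exprS mulrACA.
have n0 := normc_ge0 s.
by apply: ler_pM; [| | exact: hk' | exact: hk];
  rewrite mulr_ge0 ?exprn_ge0 //; lra.
Qed.

(** Each factor satisfies |s - r| >= Re s. The constant involves only the leading coefficient and
    not the roots, so the bound survives a limit of Hurwitz polynomials. *)
Lemma hurwitz_lower_lead p s : hurwitz p -> 0 <= complex.Re s ->
  normc (lead_coef p) * complex.Re s ^+ (size p).-1 <= normc p.[s].
Proof.
have [->|p0] := eqVneq p 0.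
  by rewrite lead_coef0 horner0 Normc.normc0 mul0r.
move=> hp s0; have [rs [-> rs0 pE]] := hurwitz_factor hp p0.
rewrite pE Normc.normcM ler_wpM2l ?normc_ge0 //.
elim: rs rs0 {pE} => [|r rs IH] /= => [_|/andP[r0 /IH h]].
  by rewrite big_nil Normc.normc1 expr0.
rewrite big_cons Normc.normcM exprS; apply: ler_pM => //.
  by rewrite exprn_ge0.
apply: le_trans (ReleNormc _); move: r0; case: (r) (s) => a b [x y] /=; lra.
Qed.

Variables (n : nat) (c : nat -> {poly R}).

Definition hpoly (t : R) : {poly C} := \poly_(j < n.+1) ((c j).[t])%:C.

Hypothesis lead_neq0 : forall t, 0 <= t <= 1 -> (c n).[t] != 0.
Hypothesis axis_neq0 : forall t (w : R),
  0 <= t <= 1 -> ~~ root (hpoly t) (0 +i* w).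

Lemma lead_coef_hpoly t : 0 <= t <= 1 -> lead_coef (hpoly t) = ((c n).[t])%:C.
Proof.
by move=> ht; rewrite lead_coef_poly // -(rmorph0 (real_complex R)) (inj_eq (@complexI R)) lead_neq0.
Qed.

Lemma size_hpoly t : 0 <= t <= 1 -> size (hpoly t) = n.+1.
Proof.
by move=> ht; rewrite size_poly_eq // -(rmorph0 (real_complex R)) (inj_eq (@complexI R)) lead_neq0.
Qed.

(** Each coefficient is Lipschitz in t on [0, 1], and |s|^j <= (1 + |s|)^n for j <= n, so one
    constant serves all s. The summand 1 makes B positive. *)
Lemma hpoly_lipschitz : exists2 B : R, 0 < B &
  forall t t', 0 <= t <= 1 -> 0 <= t' <= 1 ->
  `|(c n).[t] - (c n).[t']| <= B * `|t - t'| /\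
  forall s, normc ((hpoly t).[s] - (hpoly t').[s]) <=
    B * `|t - t'| * (1 + normc s) ^+ n.
Proof.
pose b j := poly_accr_bound (c j) 0 1.
have b0 j : 0 <= b j by exact: poly_accr_bound_ge0.
have hb j t t' : 0 <= t <= 1 -> 0 <= t' <= 1 ->
    `|(c j).[t] - (c j).[t']| <= `|t - t'| * b j.
  move=> /andP[t0 t1] /andP[u0 u1]; apply: poly_accr_bound1P.
    by rewrite subr0 ger0_norm.
  by rewrite subr0 ger0_norm.
exists (1 + \sum_(j < n.+1) b j) => [|t t' ht ht'].
  by rewrite ltr_pwDl // sumr_ge0.
split.
  apply: le_trans (hb n _ _ ht ht') _; rewrite mulrC ler_wpM2r //.
  rewrite (bigD1 ord_max) //= addrCA lerDl addr_ge0 // sumr_ge0 //.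
move=> s; rewrite /hpoly !horner_poly -sumrB.
apply: le_trans (normc_sum _ _) _.
have s1 : 1 <= 1 + normc s by rewrite lerDl normc_ge0.
apply: (@le_trans _ _ (\sum_(j < n.+1) b j * `|t - t'| * (1 + normc s) ^+ n)).
  apply: ler_sum => j _; rewrite -mulrBl Normc.normcM normcX -rmorphB normc_rc.
  apply: ler_pM; rewrite ?exprn_ge0 ?normc_ge0 //; first by rewrite mulrC hb.
  apply: (@le_trans _ _ ((1 + normc s) ^+ j)).
    by apply: lerXn2r; rewrite ?nnegrE ?normc_ge0 ?lerDr //; lra.
  by rewrite ler_weXn2l // -ltnS.
rewrite -mulr_suml -mulr_suml ler_wpM2r ?exprn_ge0 //; first lra.
by rewrite ler_wpM2r // lerDr.
Qed.

(** At a root s of [hpoly t'] with Re s >= 0, the value of [hpoly t] would be at most B |t - t'| (1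
    + |s|)^n, which is below the bound of [hurwitz_lower] once |t - t'| < k / B. *)
Lemma hurwitz_open t : 0 <= t <= 1 -> hurwitz (hpoly t) ->
  exists2 e : R, 0 < e &
  forall t', 0 <= t' <= 1 -> `|t - t'| < e -> hurwitz (hpoly t').
Proof.
move=> ht hp; have [B B0 hB] := hpoly_lipschitz.
have p0 : hpoly t != 0 by rewrite -size_poly_eq0 size_hpoly.
have [k k0 hk] := hurwitz_lower hp p0.
exists (k / B) => [|t' ht' lt]; first by rewrite divr_gt0.
move=> s /rootP rs; rewrite ltNge; apply/negP => s0.
have := hk _ s0; rewrite size_hpoly //= leNgt => /negP; apply.
have [_ /(_ s)] := hB _ _ ht ht'; rewrite rs subr0 => h.
apply: le_lt_trans h _; rewrite ltr_pM2r.
  by rewrite mulrC -ltr_pdivlMr.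
by rewrite exprn_gt0 // ltr_pwDl // normc_ge0.
Qed.

(** A root s of the limit is off the axis, so it would have Re s > 0. There the Hurwitz neighbours
    stay bounded away from 0 by [hurwitz_lower_lead], while the Lipschitz bound forces them towards
    0. *)
Lemma hurwitz_closed t : 0 <= t <= 1 ->
  (forall e : R, 0 < e -> exists t',
    [/\ 0 <= t' <= 1, `|t' - t| < e & hurwitz (hpoly t')]) ->
  hurwitz (hpoly t).
Proof.
move=> ht happ s /rootP rs; rewrite ltNge; apply/negP => s0.
have [B B0 hB] := hpoly_lipschitz.
have sp : 0 < complex.Re s.
  rewrite lt_def s0 andbT; apply/eqP => Re0.
  have := axis_neq0 (complex.Im s) ht.
  by rewrite (_ : 0 +i* complex.Im s = s) ?(introT rootP rs) // -Re0; case: (s).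
set X := complex.Re s ^+ n; set Y := (1 + normc s) ^+ n.
have X0 : 0 < X by rewrite exprn_gt0.
have Y0 : 0 < Y by rewrite exprn_gt0 // ltr_pwDl // normc_ge0.
pose l := `|(c n).[t]|; have l0 : 0 < l by rewrite normr_gt0 lead_neq0.
have XY : 0 < X + Y by exact: addr_gt0.
(* The estimates below give l X <= B |t' - t| (X + Y); this radius keeps the right side under l X /
   2. *)
have e0 : 0 < l * X / (2 * B * (X + Y)) by rewrite divr_gt0 ?mulr_gt0.
have [t' [ht' lt hp]] := happ _ e0.
have := hurwitz_lower_lead hp s0.
rewrite size_hpoly // lead_coef_hpoly // normc_rc -/X => h1.
have [h2 /(_ s)] := hB _ _ ht' ht; rewrite rs subr0 -/Y => h3.
have h4 : l <= `|(c n).[t']| + B * `|t' - t|.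
  rewrite /l -[(c n).[t]](subrK (c n).[t']) addrC; apply: le_trans (ler_normD _ _) _.
  by rewrite lerD2l distrC.
have h5 : `|t' - t| * (2 * B * (X + Y)) < l * X by rewrite -ltr_pdivlMr // !mulr_gt0.
have h6 : l * X <= (`|(c n).[t']| + B * `|t' - t|) * X by rewrite ler_pM2r.
move: h1 h3 h5 h6; move: `|_| (normc _) `|_ - _| => U V W; clearbody X Y l; clear -l0 X0.
have : 0 < l * X by exact: mulr_gt0.
lra.
Qed.

(** Connectedness of [0, 1]: the supremum of the initial Hurwitz intervals is itself Hurwitz by
    closedness, and openness moves it further unless it is 1. *)
Lemma hurwitz_homotopy : hurwitz (hpoly 0) -> hurwitz (hpoly 1).
Proof.
move=> h0.
pose E := [set t : R | 0 <= t <= 1 /\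
  forall u, 0 <= u <= t -> hurwitz (hpoly u)].
have E0 : E 0.
  split=> [|u u0]; first by rewrite lexx ler01.
  by have -> : u = 0 by apply/eqP; rewrite eq_le andbC.
have Eub : has_ubound E by exists 1 => t [/andP[]].
have Esup : has_sup E by split=> //; exists 0.
have s0 : 0 <= sup E by exact: ub_le_sup.
have s1 : sup E <= 1 by apply: ge_sup => [|t [/andP[]] //]; exists 0.
have hs : 0 <= sup E <= 1 by rewrite s0.
have below u : 0 <= u -> u < sup E -> hurwitz (hpoly u).
  move=> u0 us; have := sup_adherent (eps := sup E - u); rewrite subr_gt0.
  case/(_ _ us Esup) => t [_ ht]; rewrite subKr => ut.
  by apply: ht; rewrite u0 ltW.
have hsup : hurwitz (hpoly (sup E)).
  have [E00|sp] := leP (sup E) 0.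
    by have -> : sup E = 0 by apply/eqP; rewrite eq_le E00.
  apply: hurwitz_closed => // e e0.
  exists (Num.max 0 (sup E - e / 2)); split.
  - by rewrite le_max lexx /= ge_max ler01 /=; lra.
  - by rewrite maxEle; case: ifP => h; rewrite ltr_norml; apply/andP; split; lra.
  - by apply: below; rewrite ?le_max ?lexx // gt_max sp /=; lra.
have [e e0 he] := hurwitz_open hs hsup.
have [le1|lt1] := leP 1 (sup E).
  by have -> : 1 = sup E by apply/eqP; rewrite eq_le le1.
pose t := Num.min 1 (sup E + e / 2).
have tE : E t.
  have t01 : 0 <= t <= 1 by rewrite /t le_min ge_min lexx ler01 /= andbT; lra.
  split=> // u /andP[u0 ut].
  have [us|us] := ltP u (sup E); first exact: below.
  have u1 : 0 <= u <= 1 by rewrite u0 (le_trans ut) // ; case/andP: t01.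
  apply: he => //; move: ut; rewrite /t le_min => /andP[_ ut].
  by rewrite ltr_norml; apply/andP; split; lra.
have := ub_le_sup Eub tE; rewrite /t minEle; case: ifP => _; lra.
Qed.

End Homotopy.
(** * The characteristic polynomial of the loop *)

Section TopCoefficients.
Variable S : comNzRingType.

Lemma coefM_top (p q : {poly S}) a b :
  (size p <= a.+1)%N -> (size q <= b.+1)%N ->
  (p * q)`_(a + b) = p`_a * q`_b.
Proof.
move=> hp hq; have lta : (a < (a + b).+1)%N by rewrite ltnS leq_addr.
rewrite coefM (bigD1 (Ordinal lta)) //= addKn big1 ?addr0 // => i.
rewrite -val_eqE /= neq_ltn => /orP[ia|ai].
  rewrite [q`_ _]nth_default ?mulr0 // (leq_trans hq) //.
  by rewrite ltn_subRL ltn_add2r.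
by rewrite [p`_ _]nth_default ?mul0r // (leq_trans hp).
Qed.

Lemma prod_top (I : Type) (l : seq I) (f : I -> {poly S}) k :
  (forall i, (size (f i) <= k.+1)%N) ->
  (size (\prod_(i <- l) f i)%R <= (size l * k).+1)%N /\
  (\prod_(i <- l) f i)`_(size l * k) = \prod_(i <- l) (f i)`_k.
Proof.
move=> hf; elim: l => [|i l [IHs IHc]] /=.
  by rewrite !big_nil mul0n size_poly1 coef1.
rewrite !big_cons mulSn; split; last by rewrite coefM_top // IHc.
apply: leq_trans (size_polyMleq _ _) _.
by rewrite -subn1 leq_subLR add1n -addnS -addSn leq_add.
Qed.

(** Each Leibniz term is a product of m entries. As k only bounds the degrees, the coefficient at m
    k may vanish; it acts as the value of the determinant at infinity. *)
Lemma det_top m k (B : 'M[{poly S}]_m) :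
  (forall i j, (size (B i j) <= k.+1)%N) ->
  (size (\det B) <= (m * k).+1)%N /\
  (\det B)`_(m * k) = \det (map_mx (coefp k) B).
Proof.
move=> hB.
have term (s : 'S_m) :=
  @prod_top _ (enum 'I_m) (fun i => B i (s i)) k (fun i => hB i (s i)).
rewrite size_enum_ord in term.
rewrite /determinant; split.
  apply: leq_trans (size_sum _ _ _) _; apply/bigmax_leqP => s _.
  rewrite -signr_odd; case: odd; rewrite ?expr1 ?expr0 ?mul1r ?mulN1r ?size_polyN.
    by have [] := term s; rewrite big_enum.
  by have [] := term s; rewrite big_enum.
rewrite coef_sum; apply: eq_bigr => s _.
have E : (\prod_i B i (s i))`_(m * k) = \prod_i (B i (s i))`_k.
  by have [_] := term s; rewrite !big_enum.
under [in RHS]eq_bigr do rewrite mxE /=.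
by case: (odd_perm s); rewrite ?expr1 ?expr0 ?mul1r ?mulN1r ?coefN E.
Qed.

Lemma size_adj m k (B : 'M[{poly S}]_m) i j :
  (forall i j, (size (B i j) <= k.+1)%N) ->
  (size (\adj B i j) <= (m.-1 * k).+1)%N.
Proof.
move=> hB; rewrite mxE /cofactor.
have hB' a b : (size (row' j (col' i B) a b) <= k.+1)%N by rewrite !mxE.
have [hs _] := det_top hB'.
by rewrite -signr_odd; case: odd; rewrite ?expr1 ?expr0 ?mul1r ?mulN1r ?size_polyN.
Qed.

End TopCoefficients.

(** * Polynomial fractions and a common denominator of G *)

Section CommonDenominator.
Variable R : realType.
Local Notation C := R[i].
Local Notation "x %:F" := (@FracField.tofrac {poly R} x).

(** Lets evaluation be pushed through products and determinants. *)
Lemma ceval_rmorphism (s : C) : exists f : {rmorphism {poly R} -> C},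
  forall p, f p = ceval p s.
Proof.
have h : commr_rmorph (real_complex R) s by move=> x; exact: mulrC.
by exists (horner_morph h).
Qed.

Lemma cevalM p q (s : C) : ceval (p * q) s = ceval p s * ceval q s.
Proof. by rewrite /ceval rmorphM hornerM. Qed.

(** Real coefficients commute with conjugation. With a = 0 this reduces negative frequencies to
    positive ones. *)
Lemma ceval_conj (p : {poly R}) (a b : R) :
  ceval p (a -i* b) = 0 <-> ceval p (a +i* b) = 0.
Proof.
have conjP s : ceval p (s^*)%C = (ceval p s)^*%C.
  rewrite /ceval -horner_map; congr (_.[_]); rewrite -map_poly_comp.
  by apply: eq_map_poly => x /=; rewrite oppr0.
rewrite -[a -i* b]/((a +i* b)^*)%C conjP; split=> [/eqP|->]; last exact: conjc0.
by rewrite conjc_eq0 => /eqP.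
Qed.

Lemma ratfun_fraction (f : ratfun R) (N p : {poly R}) :
  p != 0 -> f = N%:F / p%:F ->
  rnum f * p = N * rden f.
Proof.
move=> p0 fE; apply/eqP; rewrite -tofrac_eq !rmorphM /=.
have cross (K : fieldType) (a b c e : K) :
    b != 0 -> e != 0 -> a / b = c / e -> c * b = a * e.
  by move=> b0 e0 /eqP; rewrite eqr_div // => /eqP ->.
by apply/eqP/cross; rewrite ?tofrac_eq0 ?rden_neq0 // -fE -ratfunE.
Qed.

(** [rden f] divides [rnum f * p] and is coprime to [rnum f]. Thus poles can be located with any
    denominator. *)
Lemma rden_dvd (f : ratfun R) (N p : {poly R}) :
  p != 0 -> f = N%:F / p%:F -> rden f %| p.
Proof.
move=> p0 /(ratfun_fraction p0) E.
have h : coprimep (rden f) (rnum f) by rewrite coprimep_sym coprimep_rnum_rden.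
by rewrite -(Gauss_dvdpr _ h) E dvdp_mull.
Qed.

Lemma rden_dvd_pole (f : ratfun R) (N p : {poly R}) s :
  p != 0 -> f = N%:F / p%:F ->
  is_pole f s -> ceval p s = 0.
Proof.
move=> p0 fE; have := rden_dvd p0 fE.
by rewrite dvdp_eq => /eqP -> hp; rewrite cevalM hp mulr0.
Qed.

(** Cross-multiplication preserves the difference of degrees, so any fraction for f decides
    properness. *)
Lemma proper_fraction (f : ratfun R) (N p : {poly R}) :
  p != 0 -> f = N%:F / p%:F ->
  (size N <= size p)%N -> Defs.proper f.
Proof.
move=> p0 fE hs; have E := ratfun_fraction p0 fE; rewrite /Defs.proper.
have [->|r0] := eqVneq (rnum f) 0; first by rewrite size_poly0.
have N0 : N != 0.
  apply: contraTneq isT => N0; move/eqP: E.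
  by rewrite N0 mul0r mulf_eq0 (negPf r0) (negPf p0).
have := congr1 (fun q : {poly R} => size q) E.
rewrite !size_mul ?rden_neq0 //.
move: r0 p0 N0 (rden_neq0 f) hs; rewrite -!size_poly_gt0.
move: (size (rnum f)) (size p) (size N) (size (rden f)) => a b c e; lia.
Qed.

Lemma freq_fun0 (w : \bar R) : freq_fun 0 w = 0.
Proof.
have r0 : rnum (0 : ratfun R) = 0.
  have /eqP := ratfunE (0 : ratfun R); rewrite eq_sym mulf_eq0 invr_eq0.
  by rewrite !tofrac_eq0 (negPf (rden_neq0 _)) orbF => /eqP.
by case: w => [w||]; rewrite /freq_fun r0 ?coef0 ?mul0r // /ceval rmorph0 horner0 mul0r.
Qed.

(** The product of all entry denominators serves as d, since only the location of its roots matters.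
    At infinity, coefficients at the degree of d play the part of values. *)
Lemma RHinf_common_denominator m (G : 'M[ratfun R]_m) : RHinf G ->
  exists (d : {poly R}) (A : 'M[{poly R}]_m),
  [/\ d != 0, forall s, ceval d s = 0 -> complex.Re s < 0,
      forall i j, (size (A i j) <= size d)%N,
      map_mx (@FracField.tofrac {poly R}) A = d%:F *: G &
      (forall w : R, map_mx (fun p => ceval p (0 +i* w)) A =
        ceval d (0 +i* w) *: freq_resp G w%:E) /\
      map_mx (fun p : {poly R} => (p`_(size d).-1)%:C) A =
        (lead_coef d)%:C *: freq_resp G +oo%E].
Proof.
move=> hG.
have cancel (K : fieldType) (a b c : K) : c != 0 -> a * b = c * b * (a / c).
  by move=> c0; field.
pose den (x : 'I_m * 'I_m) := rden (G x.1 x.2).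
pose e i j := \prod_(x | x != (i, j)) den x.
pose d := \prod_x den x.
have dE i j : d = rden (G i j) * e i j by rewrite /d (bigD1 (i, j)).
have d0 : d != 0 by apply/prodf_neq0 => x _; exact: rden_neq0.
have dH s : ceval d s = 0 -> complex.Re s < 0.
  have [f fE] := ceval_rmorphism s; rewrite -fE rmorph_prod => /eqP/prodf_eq0[x _].
  by rewrite fE => /eqP h; have [_] := hG x.1 x.2; apply.
have e0 i j : e i j != 0 by apply/prodf_neq0 => x _; exact: rden_neq0.
exists d, (\matrix_(i, j) (rnum (G i j) * e i j)); split=> //.
- move=> i j; rewrite mxE (dE i j); have [-> | r0] := eqVneq (rnum (G i j)) 0.
    by rewrite mul0r size_poly0.
  rewrite !size_mul ?rden_neq0 //.
  by have [hp _] := hG i j; rewrite -!subn1 leq_sub2r // leq_add2r.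
- apply/matrixP => i j; rewrite !mxE (dE i j) {3}(ratfunE (G i j)) !rmorphM /=.
  by apply: cancel; rewrite tofrac_eq0 rden_neq0.
split=> [w|]; apply/matrixP => i j; rewrite !mxE.
- rewrite (dE i j) !cevalM /= [RHS]mulrC mulrA divfK 1?mulrC //.
  apply/eqP => h; have [_ /(_ _ h)] := hG i j.
  by rewrite ltxx.
- rewrite (dE i j) /= -rmorphM; congr (_ %:C).
  have [hp _] := hG i j.
  have sd : (0 < size (rden (G i j)))%N by rewrite size_poly_gt0 rden_neq0.
  have se : (0 < size (e i j))%N by rewrite size_poly_gt0.
  rewrite size_mul ?rden_neq0 // lead_coefM.
  have -> : (size (rden (G i j)) + size (e i j)).-1.-1 =
     ((size (rden (G i j))).-1 + (size (e i j)).-1)%N by lia.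
  rewrite coefM_top ?prednK // -/(lead_coef (e i j)).
  by apply: cancel; rewrite lead_coef_eq0 rden_neq0.
Qed.

End CommonDenominator.

(** * The loop polynomial, its degree and its roots *)

Section CharacteristicPolynomial.
Variable R : realType.
Local Notation C := R[i].
Local Notation "x %:F" := (@FracField.tofrac {poly R} x).
Variables (m : nat) (d : {poly R}) (A : 'M[{poly R}]_m) (H : 'M[R]_m).
Local Notation k := (size d).-1.
Hypothesis d0 : d != 0.
Hypothesis dH : forall s, ceval d s = 0 -> complex.Re s < 0.
Hypothesis Asize : forall i j, (size (A i j) <= size d)%N.

(** For A = d G this is d (1 + t G H), cleared of denominators. *)
Definition loop_mx (t : R) : 'M[{poly R}]_m :=
  d%:M + t%:P *: (A *m map_mx polyC H).

Definition loop_poly (t : R) : {poly R} := \det (loop_mx t).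

(* [loop_poly t] with [t] turned into an inner polynomial variable. *)
Let loop_biv : {poly {poly R}} := \det ((map_poly polyC d)%:M +
  ('X)%:P *: map_mx (map_poly polyC) (A *m map_mx polyC H)).
Let loop_coef j : {poly R} := loop_biv`_j.

Lemma size_loop_mx t i j : (size (loop_mx t i j) <= k.+1)%N.
Proof.
have dk : k.+1 = size d by rewrite prednK // size_poly_gt0.
rewrite dk !mxE; apply: leq_trans (size_polyD _ _) _; rewrite geq_max; apply/andP; split.
  by case: eqP; rewrite ?mulr1n ?mulr0n ?size_poly0.
rewrite mul_polyC; apply: leq_trans (size_scale_leq _ _) _.
apply: leq_trans (size_sum _ _ _) _; apply/bigmax_leqP => l _.
by rewrite mxE mulrC mul_polyC; apply: leq_trans (size_scale_leq _ _) _.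
Qed.

Lemma loop_bivE t : map_poly (horner_eval t) loop_biv = loop_poly t.
Proof.
have EV (p : {poly R}) : map_poly (horner_eval t) (map_poly polyC p) = p.
  rewrite -map_poly_comp /= map_poly_id // => x _ /=.
  by rewrite /horner_eval hornerC.
rewrite /loop_biv -det_map_mx /loop_poly; apply: (congr1 determinant).
rewrite map_mxD map_scalar_mx map_mxZ /= EV map_polyC /= /horner_eval hornerX.
congr (_ + _ *: _); apply/matrixP => a b; rewrite mxE mxE; exact: EV.
Qed.

Lemma loop_coefE t j : (loop_coef j).[t] = (loop_poly t)`_j.
Proof. by rewrite -loop_bivE coef_map. Qed.

(** Puts the loop polynomial into the form of the homotopy argument: fixed nominal degree m k and
    coefficients polynomial in t. *)
Lemma hpoly_loop t :
  hpoly (m * k) loop_coef t = map_poly (real_complex R) (loop_poly t).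
Proof.
have [hs _] := det_top (size_loop_mx t).
apply/polyP => j; rewrite coef_poly coef_map loop_coefE.
case: ltnP => // hj; rewrite [RHS]/=.
by rewrite [X in X%:C]nth_default ?(leq_trans hs).
Qed.

(** Applied with D the value of d on the axis, and with D its leading coefficient at infinity. *)
Lemma det_pencil (t D : C) (Am F : 'M[C]_m) (Hc : 'M[C]_m) : Am = D *: F ->
  \det (D%:M + t *: (Am *m Hc)) = D ^+ m * \det (1%:M + t *: (F *m Hc)).
Proof.
move=> ->; rewrite -detZ scalerDr scale_scalar_mx mulr1; congr (\det (_ + _)).
by rewrite -scalemxAl !scalerA mulrC.
Qed.

Lemma ceval_loop t s : ceval (loop_poly t) s =
  \det ((ceval d s)%:M +
    t%:C *: (map_mx (fun p => ceval p s) A *m map_mx (real_complex R) H)).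
Proof.
have [f fE] := ceval_rmorphism s.
have fC c : f c%:P = c%:C by rewrite fE /ceval map_polyC hornerC.
rewrite -fE -det_map_mx /loop_mx map_mxD map_scalar_mx map_mxZ map_mxM fE fC.
congr (\det (_ + _ *: (_ *m _))); apply/matrixP => i j.
  by rewrite 2!mxE; exact: fE.
by rewrite 3!mxE; exact: fC.
Qed.

Lemma loop_top t : ((loop_poly t)`_(m * k))%:C =
  \det (((lead_coef d)%:C)%:M +
    t%:C *: (map_mx (fun p : {poly R} => (p`_k)%:C) A *m
      map_mx (real_complex R) H)).
Proof.
have [_ ->] := det_top (size_loop_mx t).
rewrite -[LHS]det_map_mx; congr (\det _); apply/matrixP => i j.
rewrite !mxE /= coefD rmorphD /=; congr (_ + _).
  by case: eqP; rewrite ?mulr1n ?mulr0n ?coef0.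
rewrite coefCM rmorphM; congr (_ * _); rewrite coef_sum rmorph_sum.
by apply: eq_bigr => l _; rewrite !mxE coefMC rmorphM.
Qed.

Variable G : 'M[ratfun R]_m.
Hypothesis AG : map_mx (@FracField.tofrac {poly R}) A = d%:F *: G.
Hypothesis Afreq : forall w : R,
  map_mx (fun p => ceval p (0 +i* w)) A = ceval d (0 +i* w) *: freq_resp G w%:E.
Hypothesis Ainf : map_mx (fun p : {poly R} => (p`_k)%:C) A =
  (lead_coef d)%:C *: freq_resp G +oo%E.
Hypothesis regular : forall (w : \bar R) (t : R), (0 <= w)%E -> 0 < t <= 1 ->
  \det (1%:M + t%:C *: (freq_resp G w *m map_mx (real_complex R) H)) != 0.

Lemma ceval_axis_neq0 (w : R) : ceval d (0 +i* w) != 0.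
Proof. by apply/eqP => /dH; rewrite ltxx. Qed.

Lemma loop_poly0 : loop_poly 0 = d ^+ m.
Proof. by rewrite /loop_poly /loop_mx polyC0 scale0r addr0 det_scalar. Qed.

(** Regularity at w = +oo keeps the degree constant along the homotopy, so no root escapes to
    infinity. At t = 0, which regularity leaves out, the coefficient is a power of the leading
    coefficient of d. *)
Lemma loop_poly_top_neq0 t : 0 <= t <= 1 -> (loop_poly t)`_(m * k) != 0.
Proof.
move=> /andP[t0 t1].
have l0 : (lead_coef d)%:C ^+ m != 0 :> C.
  by rewrite expf_neq0 // -(rmorph0 (real_complex R)) (inj_eq (@complexI R)) lead_coef_eq0.
rewrite -(inj_eq (@complexI R)) rmorph0 loop_top.
have [->|tn] := eqVneq t 0.
  by rewrite rmorph0 scale0r addr0 det_scalar.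
by rewrite (det_pencil _ _ Ainf) mulf_neq0 // regular ?leey // lt_def tn t0.
Qed.

Lemma loop_poly_axis_neq0 t (w : R) :
  0 <= t <= 1 -> ceval (loop_poly t) (0 +i* w) != 0.
Proof.
move=> /andP[t0 t1].
wlog w0 : w / 0 <= w.
  move=> hw; have [|wn] := leP 0 w; first exact: hw.
  apply/eqP => /ceval_conj; apply/eqP; apply: hw.
  by rewrite oppr_ge0 ltW.
have l0 : ceval d (0 +i* w) ^+ m != 0 by rewrite expf_neq0 // ceval_axis_neq0.
rewrite ceval_loop.
have [->|tn] := eqVneq t 0.
  by rewrite rmorph0 scale0r addr0 det_scalar.
by rewrite (det_pencil _ _ (Afreq w)) mulf_neq0 // regular ?lee_fin // lt_def tn t0.
Qed.

Lemma loop_poly_hurwitz s : ceval (loop_poly 1) s = 0 -> complex.Re s < 0.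
Proof.
suff : hurwitz (hpoly (m * k) loop_coef 1).
  by move=> /(_ s) h e; apply: h; rewrite hpoly_loop; apply/rootP.
apply: hurwitz_homotopy.
- by move=> t ht; rewrite loop_coefE loop_poly_top_neq0.
- by move=> t w ht; rewrite hpoly_loop; exact: loop_poly_axis_neq0.
- move=> z; rewrite hpoly_loop loop_poly0 => /rootP.
  rewrite rmorphXn horner_exp => /eqP; rewrite expf_eq0 => /andP[_ /eqP].
  exact: dH.
Qed.

Lemma loop_poly1_neq0 : loop_poly 1 != 0.
Proof.
have := @loop_poly_top_neq0 1; rewrite ler01 lexx => /(_ isT).
by apply: contraNneq => ->; rewrite coef0.
Qed.

Lemma size_loop_poly1 : (m * k < size (loop_poly 1))%N.
Proof.
rewrite ltnNge; apply/negP => h.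
have := @loop_poly_top_neq0 1; rewrite ler01 lexx => /(_ isT).
by rewrite nth_default ?eqxx.
Qed.

(** By Cramer's rule the inverse is d times the adjugate of [loop_mx 1] over [loop_poly 1]. Its
    poles are roots of [loop_poly 1], and its numerators have degree at most k + (m - 1) k = m k. *)
Lemma regular_feedback_stable : feedback_stable G H.
Proof.
rewrite /feedback_stable; set M := 1%:M + _.
have dF : d%:F != 0 by rewrite tofrac_eq0.
have pF : (loop_poly 1)%:F != 0 by rewrite tofrac_eq0 loop_poly1_neq0.
have ME : d%:F *: M = map_mx (@FracField.tofrac {poly R}) (loop_mx 1).
  rewrite /loop_mx map_mxD map_scalar_mx polyC1 scale1r map_mxM AG /M scalerDr.
  rewrite scale_scalar_mx mulr1 -scalemxAl; congr (_ + _ *: (_ *m _)).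
  by apply/matrixP => i j; rewrite !mxE.
pose X := (d%:F / (loop_poly 1)%:F) *:
  map_mx (@FracField.tofrac {poly R}) (\adj (loop_mx 1)).
have MX : M *m X = 1%:M.
  rewrite /X -scalemxAr mulrC -scalerA scalemxAl ME -map_mxM mul_mx_adj.
  by rewrite map_scalar_mx scale_scalar_mx mulVf.
have [Mu Xu] := mulmx1_unit MX.
split; first exact: Mu.
move=> i j.
have -> : invmx M = X by rewrite -[X]mul1mx -(mulVmx Mu) -mulmxA MX mulmx1.
have XE : X i j = (d * \adj (loop_mx 1) i j)%:F / (loop_poly 1)%:F.
  by rewrite mxE mxE rmorphM mulrAC.
split; last first.
  move=> s hs; apply: loop_poly_hurwitz.
  exact: rden_dvd_pole loop_poly1_neq0 XE hs.
apply: proper_fraction loop_poly1_neq0 XE _.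
apply: leq_trans _ size_loop_poly1.
apply: leq_trans (size_polyMleq _ _) _.
have ha := size_adj i j (size_loop_mx 1).
have sd : (0 < size d)%N by rewrite size_poly_gt0.
have m0 : (0 < m)%N by apply: leq_ltn_trans (leq0n i) (ltn_ord i).
have -> : (m * k = k + m.-1 * k)%N by rewrite -{1}(prednK m0) mulSn.
move: ha sd; move: (size (\adj (loop_mx 1) i j)) (m.-1 * k)%N (size d) => a b e.
lia.
Qed.

End CharacteristicPolynomial.

(** * Frequency response of a block-diagonal matrix *)

Section BlockFrequencyResponse.
Variable R : realType.

(** Stated for maps that fix 0, because [freq_fun] need not be additive at poles on the axis. *)
Lemma map_mxdiag (V W : nmodType) (f : V -> W) p (p_ : 'I_p -> nat)
  (B : forall i, 'M[V]_(p_ i)) : f 0 = 0 ->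
  map_mx f (mxdiag B) = mxdiag (fun i => map_mx f (B i)).
Proof.
move=> f0.
have map_block (D : forall i j, 'M[V]_(p_ i, p_ j)) :
    map_mx f (\mxblock_(i, j) D i j) = \mxblock_(i, j) map_mx f (D i j).
  by apply/matrixP => i j; rewrite !mxE.
rewrite /mxdiag map_block; apply/eq_mxblock => i j.
case: eqVneq => [->|_]; first by rewrite !conform_mx_id.
by apply/matrixP => a b; rewrite !mxE.
Qed.

Lemma freq_resp_mxdiag p (p_ : 'I_p -> nat) (B : forall i, 'M[ratfun R]_(p_ i))
  w :
  freq_resp (mxdiag B) w = mxdiag (fun i => freq_resp (B i) w).
Proof. by rewrite /freq_resp map_mxdiag // freq_fun0. Qed.

End BlockFrequencyResponse.

Theorem mainTheorem1 (R : realType) (N : nat)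
  (kappa : 'I_N.+1 -> R) (Psi V : 'I_N.+1 -> set R)
  (Sop : 'I_N.+1 -> set 'cV[R]_3)
  (hS : forall i, Sop i `<=` admissible (kappa i) (Psi i) (V i))
  (hS0 : forall i, Sop i !=set0)
  (n : 'I_N.+1 -> nat)
  (Gi : forall i, 'cV[R]_3 -> 'M[ratfun R]_((n i).+1))
  (G : ('I_N.+1 -> 'cV[R]_3) -> 'M[ratfun R]_(\sum_i (n i).+1))
  (H : 'M[R]_(\sum_i (n i).+1))
  (hG : forall O, (forall i, Sop i (O i)) -> RHinf (G O))
  (hGdiag : forall O, (forall i, Sop i (O i)) ->
     G O = mxdiag (p_ := fun i => (n i).+1) (fun i => Gi i (O i)))
  (hH : posdef H) :
  let Hinv := map_mx (real_complex R) (invmx H) in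
  let F (O : 'I_N.+1 -> 'cV[R]_3) (w : \bar R) i := freq_resp (Gi i (O i)) w in
  ((forall O w, (forall i, Sop i (O i)) -> (0 <= w)%E ->
      [\/ gain_cond (F O w) Hinv, phase_cond (F O w),
          xz_cond (F O w) Hinv | SRG_cond (F O w) Hinv]) ->
   forall O, (forall i, Sop i (O i)) -> feedback_stable (G O) H)
  /\
  (forall O w, (forall i, Sop i (O i)) -> (0 <= w)%E ->
     xz_cond (F O w) Hinv <-> SRG_cond (F O w) Hinv).
Proof.
split=> [hcond O hO|O w _ _]; last by apply: iff_sym; exact: SRG_condP.
have [d [A [d0 dH Asize AG [Afreq Ainf]]]] := RHinf_common_denominator (hG O hO).
apply: (regular_feedback_stable d0 dH Asize AG Afreq Ainf) => w t w0 t01.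
rewrite (hGdiag O hO) freq_resp_mxdiag.
exact: frequency_regular hH erefl (hcond O w hO w0) t01.
Qed.
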